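(* Let $k>d\ge1$ be integers, and let $\mathcal{R}_d$ be the collection of aligned rectangles in $\mathbb{R}^d$ with non-empty interior and all vertices in $\mathbb{Z}^d$ (aligned means all faces are parallel to coordinate hyperplanes). The following are equivalent: (C1') There exists a $k$ to $d$ cubical cut and project set which is $\mathrm{LR}_\Omega$ with respect to $\mathcal{R}_d$. (C2') There exist positive integers $m_1,\ldots,m_{k-d}$ with $d=m_1+\cdots+m_{k-d}$ and such that, for each $1\le i\le k-d$, we can find real numbers $\alpha_{i1},\ldots,\alpha_{im_i}$ satisfying $$\liminf_{n\to\infty} n\|n\alpha_{i1}\|\cdots\|n\alpha_{im_i}\|>0,$$ where $n$ runs over positive integers and $\|x\|$ denotes the distance from $x\in\mathbb{R}$ to the nearest integer.
   Context: **Cut and project sets.** Let $k>d\ge1$ be integers and $e_1,\dots,e_k$ the standard basis of $\mathbb{R}^k$. Let $E\subseteq\mathbb{R}^k$ be a $d$-dimensional subspace, $F_\pi\subseteq\mathbb{R}^k$ a subspace complementary to $E$, and $\pi:\mathbb{R}^k\to E$ the projection with respect to $\mathbb{R}^k=E+F_\pi$; it is assumed that $\pi|_{\mathbb{Z}^k}$ is injective. For a set (window) $\mathcal{W}_\pi\subseteq F_\pi$ put $\mathcal{S}=\mathcal{W}_\pi+E$ (the strip). For $s\in\mathbb{R}^k/\mathbb{Z}^k$, the set $Y=Y_s=\pi(\mathcal{S}\cap(\mathbb{Z}^k+s))\subseteq E$ is called a $k$ to $d$ cut and project set. It is regular if $(\mathbb{Z}^k+s)\cap\partial\mathcal{S}=\emptyset$.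 $E$ is totally irrational if its canonical projection to $\mathbb{R}^k/\mathbb{Z}^k$ is dense. $Y$ is aperiodic if the only $x\in E$ with $Y+x=Y$ is $x=0$. Let $F_\rho=\{0\}\times\mathbb{R}^{k-d}$; it is assumed that $E$ is complementary to $F_\rho$ (so $E$ is the graph of a linear map $\mathbb{R}^d\to\mathbb{R}^{k-d}$). Let $\rho:\mathbb{R}^k\to E$ be the projection with respect to $\mathbb{R}^k=E+F_\rho$. Put $\mathcal{W}=\mathcal{S}\cap F_\rho$ (also called the window; $\mathcal{S}=\mathcal{W}+E$). The window is cubical if $\mathcal{W}=\{\sum_{i=d+1}^k t_ie_i:0\le t_i<1\}$. A cubical cut and project set is a regular, totally irrational (meaning $E$ is totally irrational), aperiodic cut and project set with cubical window. **Patterns.** Subsets of $\mathbb{R}^d$ are regarded as subsets of $\langle e_1,\dots,e_d\rangle_{\mathbb{R}}\subseteq\mathbb{R}^k$, and as subsets of $E$ via $\rho$. For $y\in Y$, $\tilde y\in\mathbb{Z}^k$ is the unique point with $\pi(\tilde y+s)=y$. For bounded $\Omega\subseteq\mathbb{R}^d$ and $y\in Y$, the patch of shape $\Omega$ at $y$ is $P(y,\Omega)=\{y'\in Y:\rho(\tilde y'-\tilde y)\in\rho(\Omega)\}$. Patches $P(y_1,\Omega)$ and $P(y_2,\Omega)$ are equivalent if $P(y_1,\Omega)=P(y_2,\Omega)+y_1-y_2$; a pattern of shape $\Omega$ is an equivalence class of patches. A pattern of shape $\Omega$ occurs in a region $R\subseteq\mathbb{R}^d$ if there is $y\in Y\cap\rho(R)$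 such that $P(y,\Omega)$ belongs to that class. **$\mathrm{LR}_\Omega$.** For a collection $\mathcal{A}$ of bounded subsets of $\mathbb{R}^d$, $Y$ is $\mathrm{LR}_\Omega$ with respect to $\mathcal{A}$ if there is a constant $C>0$ such that for every set $\Omega\in\mathcal{A}$, every pattern of shape $\Omega$ in $Y$ occurs in every translate of $C\Omega$ in $\mathbb{R}^d$. (The subscript $\Omega$ in the name $\mathrm{LR}_\Omega$ is only notation.)
   Formalization: The rectangles in R_d are additionally required to contain the origin; with rectangles at arbitrary positions (C1') fails for every 2 to 1 cubical cut and project set (take Ω=[N,N+1] with Nα very near an integer), while (C2') holds for k=2, d=1. *)

(* Defs.v *)
From HB Require Import structures.
From mathcomp Require Export all_boot all_order all_algebra.
From mathcomp Require Export all_classical all_reals all_analysis.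
Import Order.TTheory GRing.Theory Num.Theory.
Import numFieldNormedType.Exports.

Set Implicit Arguments.
Unset Strict Implicit.
Unset Printing Implicit Defensive.

Local Open Scope classical_set_scope.
Local Open Scope ring_scope.

Section Ambient.
Variable R : realType.

Definition int_lattice (n : nat) : set 'rV[R]_n :=
  [set x | x \is a mxOver Num.int].

Definition basis_vec (n : nat) (j : 'I_n) : 'rV[R]_n := delta_mx 0 j.

Definition boundary (T : topologicalType) (A : set T) : set T :=
  closure A `\` A°.

Definition complementary (n : nat) (U V : {vspace 'rV[R]_n}) : Prop :=
  (U + V)%VS = fullv /\ (U :&: V)%VS = 0%VS.

(* The torus R^n / Z^n with its quotient topology. *)
Definition torus_rel (n : nat) : rel 'rV[R]_n :=
  fun x y => x - y \is a mxOver Num.int.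

Lemma torus_rel_is_equiv (n : nat) :
  equiv_class_of (@torus_rel n).
Proof.
rewrite /torus_rel; split.
- by move=> x; apply/mxOverP => i j; rewrite subrr mxE int_num0.
- by move=> x y; apply/mxOverP/mxOverP => xy i j;
    rewrite -opprB mxE rpredN.
- move=> y x z /mxOverP xy /mxOverP yz; apply/mxOverP => i j.
  have -> : x - z = (x - y) + (y - z) by rewrite addrA subrK.
  by rewrite mxE rpredD.
Qed.

Canonical torus_equiv (n : nat) := EquivRelPack (torus_rel_is_equiv n).

Definition torus (n : nat) :=
  quotient_topology {eq_quot (torus_equiv n)}%qT.

Definition torus_proj (n : nat) (x : 'rV[R]_n) : torus n :=
  (\pi_(torus n) x)%qT.

Definition totally_irrational (n : nat) (E : {vspace 'rV[R]_n}) : Prop :=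
  dense (@torus_proj n @` [set` E]).

(* R^d is identified with the span of the first d basis vectors of R^k. *)
Definition embed (k d : nat) (v : 'rV[R]_d) : 'rV[R]_k := v *m pid_mx d.

(* {0} x R^(k-d) *)
Definition Frho (k d : nat) : {vspace 'rV[R]_k} :=
  (\sum_(j < k | (d <= j)%N) <[basis_vec j]>)%VS.

End Ambient.

(* [cps_shift] is a representative in R^k of a point s of R^k / Z^k; nothing
   below depends on the choice of the representative. *)
Record cut_project (R : realType) (k d : nat) := CutProject {
  cps_E : {vspace 'rV[R]_k};
  cps_Fpi : {vspace 'rV[R]_k};
  cps_Wpi : set 'rV[R]_k;
  cps_shift : 'rV[R]_k;
  cps_dim : \dim cps_E = d;
  cps_compl_pi : complementary cps_E cps_Fpi;
  cps_compl_rho : complementary cps_E (Frho R k d);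
  cps_inj : set_inj (@int_lattice R k) (daddv_pi cps_E cps_Fpi);
  cps_Wpi_sub : cps_Wpi `<=` [set` cps_Fpi]
}.

Section CutAndProject.
Variables (R : realType) (k d : nat) (S : cut_project R k d).

(* Both projections are onto the physical space E. *)
Definition cps_pi : 'rV[R]_k -> 'rV[R]_k := daddv_pi (cps_E S) (cps_Fpi S).
Definition cps_rho : 'rV[R]_k -> 'rV[R]_k := daddv_pi (cps_E S) (Frho R k d).

Definition strip : set 'rV[R]_k :=
  [set w + e | w in cps_Wpi S & e in [set` cps_E S]].

Definition window : set 'rV[R]_k := strip `&` [set` Frho R k d].

Definition shifted_lattice : set 'rV[R]_k :=
  [set z + cps_shift S | z in @int_lattice R k].

Definition cps_set : set 'rV[R]_k := cps_pi @` (strip `&` shifted_lattice).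

Definition regular_cps : Prop := shifted_lattice `&` boundary strip = set0.

Definition aperiodic_cps : Prop :=
  forall x, x \in cps_E S -> [set y + x | y in cps_set] = cps_set -> x = 0.

Definition cubical_window : Prop :=
  window = [set \sum_(j < k | (d <= j)%N) t j *: basis_vec R j
           | t in [set t : 'I_k -> R |
                    forall j : 'I_k, (d <= j)%N -> 0 <= t j < 1]].

Definition cubical_cps : Prop :=
  [/\ regular_cps, totally_irrational (cps_E S), aperiodic_cps
    & cubical_window].

(* The point of Z^k above y; it exists for y in Y, and is then unique by
   injectivity of pi on Z^k. *)
Definition tilde (y : 'rV[R]_k) : 'rV[R]_k :=
  xget 0 [set z | int_lattice z /\ cps_pi (z + cps_shift S) = y].

(* A subset of R^d regarded as a subset of E. *)
Definition rho_img (A : set 'rV[R]_d) : set 'rV[R]_k :=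
  cps_rho @` (@embed R k d @` A).

Definition patch (Omega : set 'rV[R]_d) (y : 'rV[R]_k) : set 'rV[R]_k :=
  [set y' | cps_set y' /\ rho_img Omega (cps_rho (tilde y' - tilde y))].

Definition patch_equiv (Omega : set 'rV[R]_d) (y1 y2 : 'rV[R]_k) : Prop :=
  patch Omega y1 = [set z + y1 - y2 | z in patch Omega y2].

(* Equivalence of patches refers to the points at which they are based, so a
   pattern is represented by the set of base points of the patches in it. *)
Definition is_pattern (Omega : set 'rV[R]_d) (P : set 'rV[R]_k) : Prop :=
  exists2 y, cps_set y & P = [set y' | cps_set y' /\ patch_equiv Omega y' y].

Definition occurs_in (P : set 'rV[R]_k) (A : set 'rV[R]_d) : Prop :=
  exists y, (cps_set `&` rho_img A) y /\ P y.

Definition LR_Omega (F : set (set 'rV[R]_d)) : Prop :=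
  exists2 C : R, 0 < C & forall Omega, F Omega ->
    forall P, is_pattern Omega P ->
    forall t : 'rV[R]_d, occurs_in P [set t + C *: v | v in Omega].

End CutAndProject.

Section Diophantine.
Variable R : realType.

Definition aligned_box (d : nat) (a b : 'rV[R]_d) : set 'rV[R]_d :=
  [set x | forall i, a 0 i <= x 0 i <= b 0 i].

(* Aligned rectangles with non-empty interior and integral vertices.  As shapes
   of patches they contain the origin, i.e. the patch of shape Omega at y
   contains y.  Without this no cubical cut and project set would be LR_Omega
   for the collection: let E be the graph of (L_1, ..., L_(k-d)), choose N in
   Z^d such that L_1(N) is at distance eps > 0 from Z, and let Omega be
   N + [0, 1]^d.  Some pattern of shape Omega then has frequency at most eps,
   while eps is arbitrarily small and C Omega is a cube of side C. *)
Definition int_rectangles (d : nat) : set (set 'rV[R]_d) :=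
  [set Omega | [/\ exists a b : 'rV[R]_d,
                     [/\ int_lattice a, int_lattice b & Omega = aligned_box a b],
                   Omega° !=set0 & Omega 0]].

Definition dist_int (x : R) : R := inf [set `|x - z%:~R| | z in [set: int]].

(* Indexed by [n.+1], since n runs over the positive integers. *)
Definition mult_liminf (m : nat) (alpha : 'I_m -> R) : \bar R :=
  limn_einf (fun n : nat =>
    (n.+1%:R * \prod_(j < m) dist_int (n.+1%:R * alpha j))%:E).

End Diophantine.

(* Main.v *)
(** Let [E] be the graph of the linear map with columns [L_1, ..., L_(k-d)].  Points of a
    cubical cut and project set correspond to lattice points [n] of Z^d, and the pattern
    of shape [Omega] at [n] is determined by the cells containing the phases
    [c_i - L_i n] mod 1 when the circle is cut at the points [L_i N], [N] in [Omega].

    If the set is LR_Omega, every orbit enters a given cell after a step in [C Omega], so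
    that many translates of the cell cover the torus and the number of lattice points of
    [C Omega] is at least the inverse volume of the cell.  With aperiodicity
    this forces [L_i] to be, up to rational coefficients, a form in its own block [J_i]
    of the coordinates, with [||L_i N|| * prod_j max (1, |N_j|)] bounded below on that
    block.  Conversely, if the [L_i] are such block forms, cells are not too short, and
    an inhomogeneous transference shows that an arc of length about [1 / |Omega|] is hit
    in every translate of [C Omega].  The same transference relates the lower bound for
    linear forms to the one for [n ||n alpha_1|| ... ||n alpha_m||], in both directions.

    The transference is a packing argument: in the torus of the lattice attached to the
    forms only boundedly many translates of a packing box are disjoint, and a connected
    group covered by boundedly many such boxes has bounded diameter. *)

From HB Require Import structures.
From mathcomp Require Import ring lra zify.
Require Import Defs.
Import Order.TTheory GRing.Theory Num.Theory.
Import numFieldNormedType.Exports.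
Set Implicit Arguments.
Unset Strict Implicit.
Unset Printing Implicit Defensive.
Local Open Scope classical_set_scope.
Local Open Scope ring_scope.

(** * Distance to the nearest integer, and sumsets *)

Section DistInt.
Variable R : realType.
Implicit Types x y : R.

Lemma dist_int_le x (z : int) : dist_int x <= `|x - z%:~R|.
Proof.
apply: ge_inf; last by exists z.
by exists 0 => _ [w _ <-]; exact: normr_ge0.
Qed.

Lemma dist_int_ge x c : (forall z : int, c <= `|x - z%:~R|) -> c <= dist_int x.
Proof.
move=> cx; apply: lb_le_inf; first by exists `|x - 0%:~R|, 0.
by move=> _ [w _ <-].
Qed.

Lemma dist_int_ge0 x : 0 <= dist_int x.
Proof. exact: dist_int_ge. Qed.

(** The infimum is attained: every integer is at most the floor of [x] or at least the floor plus
    one, so one of these two is nearest. *)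
Lemma dist_int_nearest x : exists z : int, dist_int x = `|x - z%:~R|.
Proof.
have /andP[f0 f1] := floor_itv x; rewrite intrD in f1.
suff [z xz] : exists z : int, forall w : int, `|x - z%:~R| <= `|x - w%:~R|.
  by exists z; apply/eqP; rewrite eq_le dist_int_le dist_int_ge.
have far (w : int) : w%:~R <= (Num.floor x)%:~R :> R \/
    (Num.floor x)%:~R + 1 <= w%:~R :> R.
  rewrite ler_int -(intrD R _ 1) ler_int.
  by case: (leP w (Num.floor x)) => h; [left|right; lia].
have [h|h] := leP (x - (Num.floor x)%:~R) (2^-1 : R).
  exists (Num.floor x) => w; rewrite (ger0_norm (_ : 0 <= _)) ?subr_ge0//.
  by rewrite ler_normr; case: (far w) => ?; apply/orP; [left|right]; lra.
exists (Num.floor x + 1) => w; rewrite intrD ler0_norm; last by lra.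
by rewrite ler_normr; case: (far w) => ?; apply/orP; [left|right]; lra.
Qed.

Lemma dist_int_eq0 x : dist_int x = 0 -> exists z : int, x = z%:~R.
Proof.
have [z ->] := dist_int_nearest x.
by move/eqP; rewrite normr_eq0 subr_eq0 => /eqP; exists z.
Qed.

Lemma dist_intMn x (n : nat) : dist_int (n%:R * x) <= n%:R * dist_int x.
Proof.
have [z ->] := dist_int_nearest x.
apply: le_trans (dist_int_le _ (n%:Z * z)) _.
by rewrite intrM -mulrBr normrM normr_nat.
Qed.

Lemma dist_intB x y : dist_int (x - y) <= dist_int x + dist_int y.
Proof.
have [z ->] := dist_int_nearest x; have [w ->] := dist_int_nearest y.
apply: le_trans (dist_int_le _ (z - w)) _.
rewrite intrB (_ : _ - _ = (x - z%:~R) - (y - w%:~R)); last by ring.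
exact: ler_normB.
Qed.

Lemma dist_intDz x (z : int) : dist_int (x + z%:~R) = dist_int x.
Proof.
apply/eqP; rewrite eq_le; apply/andP; split; apply: dist_int_ge => w.
  apply: le_trans (dist_int_le _ (w + z)) _.
  by rewrite intrD (_ : _ - _ = x - w%:~R)//; ring.
apply: le_trans (dist_int_le _ (w - z)) _.
by rewrite intrB (_ : _ - _ = x + z%:~R - w%:~R)//; ring.
Qed.

Lemma dist_intN x : dist_int (- x) = dist_int x.
Proof.
apply/eqP; rewrite eq_le; apply/andP; split; apply: dist_int_ge => w.
  apply: le_trans (dist_int_le _ (- w)) _.
  by rewrite intrN -normrN opprD !opprK.
apply: le_trans (dist_int_le _ (- w)) _.
by rewrite intrN opprK -normrN opprD.
Qed.

Lemma dist_int_small x : `|x| <= 2^-1 -> dist_int x = `|x|.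
Proof.
move=> x2; apply/eqP; rewrite eq_le; apply/andP; split.
  by have := dist_int_le x 0; rewrite subr0.
apply: dist_int_ge => z.
have [->|z0] := eqVneq z 0; first by rewrite subr0.
have z1 : 1 <= `|z%:~R| :> R.
  by rewrite -intr_norm -[1]/(1%:~R) ler_int; lia.
have := lerB_dist (z%:~R) x; rewrite distrC; lra.
Qed.

End DistInt.

Section Sumset.
Variable V : zmodType.

Fixpoint sumset (D : set V) (r : nat) : set V :=
  if r is s.+1 then [set x + y | x in sumset D s & y in D] else [set 0].

Variable D : set V.
Hypothesis D0 : D 0.

Lemma sumsetS r : sumset D r `<=` sumset D r.+1.
Proof. by move=> x Dx; exists x => //; exists 0; rewrite ?addr0. Qed.

Lemma sumset_mono r s : (r <= s)%N -> sumset D r `<=` sumset D s.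
Proof.
move=> /subnK <-; elim: (s - r)%N => [|t IH] x Dx //.
by rewrite addSn; apply: sumsetS; exact: IH.
Qed.

(* If the chain of sumsets were strict up to step [2h], then choosing a point
   of step [2i+1] that is not in step [2i] would give [h] separated points. *)
Lemma sumset_cover (h : nat) :
  (forall x, D x -> D (- x)) -> (forall x, exists r, sumset D r x) ->
  (forall f : 'I_h -> V, exists i j, i != j /\ D (f i - f j)) ->
  forall x, sumset D h.*2 x.
Proof.
move=> DN gen pig x; apply: contrapT => nx.
(* A chain of sumsets that stalls once is constant from then on; as the sumsets exhaust the group,
   [x] would be reached by step [2h]. *)
have strict r : (r <= h.*2)%N -> exists g, sumset D r.+1 g /\ ~ sumset D r g.
  move=> rh; apply: contrapT => /forallNP stop.
  have sub : sumset D r.+1 `<=` sumset D r.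
    by move=> y Dy; apply: contrapT => ny; exact: (stop y).
  have all_sub t : sumset D (t + r) `<=` sumset D r.
    elim: t => // t IH y [z Dz [w Dw <-]]; apply: sub.
    by exists z; [exact: IH|exists w].
  have [s xs] := gen x; apply: nx; apply: (sumset_mono rh).
  by apply: (all_sub s); apply: sumset_mono xs; rewrite leq_addr.
have /choice [f fP] : forall i : 'I_h, exists g,
    sumset D i.*2.+1 g /\ ~ sumset D i.*2 g.
  by move=> i; apply: strict; rewrite leq_double ltnW.
(* Otherwise [f j = f i - (f i - f j)] would lie in step [2i + 2], which is at most [2j]. *)
have sep (i j : 'I_h) : (i < j)%N -> ~ D (f i - f j).
  move=> ij Dij; have [_ nj] := fP j; apply: nj.
  apply: (@sumset_mono i.*2.+2); first by rewrite -doubleS leq_double.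
  exists (f i); first by case: (fP i).
  by exists (- (f i - f j)); [exact: DN|rewrite opprB addrC subrK].
have [i [j [ij Dij]]] := pig f.
have [lt_ij|lt_ji|/val_inj e] := ltngtP i j.
- exact: sep lt_ij Dij.
- by apply: (sep j i lt_ji); rewrite -opprB; exact: DN.
- by rewrite e eqxx in ij.
Qed.

End Sumset.

(** * Inhomogeneous transference *)

Lemma card_box (J : finType) (n : J -> nat) :
  #|{: {dffun forall j, 'I_(n j)}}| = (\prod_j n j)%N.
Proof.
rewrite card_dep_ffun foldrE big_map big_enum /=.
by apply: eq_bigr => j _; rewrite card_ord.
Qed.

Lemma pigeonhole (S T : finType) (f : S -> T) :
  (#|T| < #|S|)%N -> exists x y, x != y /\ f x = f y.
Proof.
move=> TS; apply: contrapT => inj.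
suff /leq_card : injective f by rewrite leqNgt TS.
move=> x y fxy; apply: contrapT => /eqP xy.
by apply: inj; exists x, y.
Qed.

Section Cell.
Variable R : realType.

(** The index of the arc containing [x] modulo 1 when the circle is cut into [K + 1] equal arcs. The
    truncation is at most [K], so the default of [inord] never occurs. *)
Definition cell (K : nat) (x : R) : 'I_K.+1 :=
  inord (Num.truncn ((x - (Num.floor x)%:~R) * K.+1%:R)).

Lemma dist_int_cell (K : nat) (x y : R) :
  cell K x = cell K y -> dist_int (x - y) < K.+1%:R^-1.
Proof.
have K0 : 0 < K.+1%:R :> R by rewrite ltr0n.
have bnd (z : R) : let t := (z - (Num.floor z)%:~R) * K.+1%:R in
    (Num.truncn t)%:R <= t < (Num.truncn t).+1%:R /\ (Num.truncn t < K.+1)%N.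
  have /andP[f0 f1] := floor_itv z; rewrite intrD in f1.
  have t0 : 0 <= (z - (Num.floor z)%:~R) * K.+1%:R.
    by rewrite mulr_ge0 ?subr_ge0// ltW.
  split; first exact: truncn_itv.
  have /andP[h _] := truncn_itv t0; rewrite -(ltr_nat R).
  by apply: le_lt_trans h _; rewrite gtr_pMl// ltrBlDl.
rewrite /cell => /(congr1 val) /=.
have [/andP[x1 x2] x3] := bnd x; have [/andP[y1 y2] y3] := bnd y.
rewrite !inordK// => e; rewrite e in x1 x2.
apply: le_lt_trans (dist_int_le _ (Num.floor x - Num.floor y)) _.
rewrite intrB -(ltr_pM2r K0) mulVf ?gt_eqF// -{1}(gtr0_norm K0) -normrM.
rewrite (_ : _ * _ = (x - (Num.floor x)%:~R) * K.+1%:R -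
   (y - (Num.floor y)%:~R) * K.+1%:R); last by ring.
move: x1 x2 y1 y2; set u := (x - _) * _; set v := (y - _) * _.
rewrite -natr1 => x1 x2 y1 y2; rewrite ltr_norml; apply/andP; split; lra.
Qed.

End Cell.

Section Transfer.
Variables (R : realType) (I J : finType) (A : J -> I -> R).
Variables (b : J -> nat) (K : I -> nat) (eps : I -> R) (h : nat).

Definition lin (N : J -> int) (i : I) : R := \sum_j (N j)%:~R * A j i.

Lemma linD N N' i : lin (fun j => N j + N' j) i = lin N i + lin N' i.
Proof. by rewrite -big_split /=; apply: eq_bigr => j _; rewrite intrD mulrDl. Qed.

Lemma linN N i : lin (fun j => - N j) i = - lin N i.
Proof. by rewrite -sumrN; apply: eq_bigr => j _; rewrite intrN mulNr. Qed.

Lemma linB N N' i : lin (fun j => N j - N' j) i = lin N i - lin N' i.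
Proof. by rewrite -linN -linD. Qed.

Lemma lin0 i : lin (fun=> 0) i = 0.
Proof. by rewrite /lin big1// => j _; rewrite mul0r. Qed.

Let V : zmodType := {ffun I -> R}.

(** Working in R^I rather than in the torus makes connectedness available through [sumset_gen]: [D]
    is the [eps]-neighbourhood of Z^I translated by the values of the forms on the box. *)
Let D : set V := [set x | exists N : J -> int,
  (forall j, `|N j| <= b j)%N /\ forall i, dist_int (lin N i - x i) < eps i].

Hypothesis Keps : forall i, (K i).+1%:R^-1 <= eps i.

Let eps_gt0 i : 0 < eps i.
Proof. by apply: lt_le_trans (Keps i); rewrite invr_gt0 ltr0n. Qed.

Let D0 : D 0.
Proof.
exists (fun=> 0); split=> // i; rewrite lin0 ffunE subr0.
by rewrite dist_int_small normr0.
Qed.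

Let DN x : D x -> D (- x).
Proof.
move=> [N [Nb Nx]]; exists (fun j => - N j); split=> [j|i]; first by rewrite abszN.
by rewrite linN ffunE -opprD dist_intN.
Qed.

Let sumset_bound r x : sumset D r x -> exists N : J -> int,
  (forall j, `|N j| <= r * b j)%N /\
  forall i, dist_int (lin N i - x i) <= r%:R * eps i.
Proof.
elim: r x => [|r IH] x /=.
  move=> ->; exists (fun=> 0); split=> // i; rewrite lin0 ffunE subr0 mul0r.
  by rewrite dist_int_small normr0.
move=> [y /IH[N [Nb Ny]] [z [N' [Nb' Nz]] <-]].
exists (fun j => N j + N' j); split=> [j|i].
  by have := Nb j; have := Nb' j; rewrite mulSn; lia.
rewrite linD ffunE -natr1 mulrDl mul1r.
rewrite (_ : _ - _ = (lin N i - y i) - - (lin N' i - z i)); last by ring.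
apply: le_trans (dist_intB _ _) _; rewrite dist_intN.
by apply: lerD; [exact: Ny|exact: ltW].
Qed.

(** This is the connectedness of R^I: [N = 0] shows that [D] contains a neighbourhood of 0, and [x]
    is the sum of [r] copies of [x / r] for large [r]. *)
Let sumset_gen x : exists r, sumset D r x.
Proof.
pose u := \sum_i `|x i| / eps i; pose r := (Num.truncn u).+1.
have r0 : 0 < r%:R :> R by rewrite ltr0n.
have ur : u < r%:R.
  have u0 : 0 <= u by rewrite sumr_ge0// => i _; rewrite divr_ge0// ltW.
  by have /andP[] := truncn_itv u0.
have Dr : D [ffun i => x i / r%:R].
  exists (fun=> 0); split=> // i; rewrite lin0 ffunE sub0r dist_intN.
  apply: le_lt_trans (dist_int_le _ 0) _; rewrite subr0 normrM normfV normr_nat.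
  rewrite ltr_pdivrMr// mulrC -ltr_pdivrMr//; apply: le_lt_trans ur.
  by rewrite /u (bigD1 i)//= lerDl sumr_ge0// => k _; rewrite divr_ge0// ltW.
have mul s : sumset D s [ffun i => x i / r%:R *+ s].
  elim: s => [|s IH] /=.
    by apply/ffunP => i; rewrite ffunE mulr0n.
  exists [ffun i => x i / r%:R *+ s] => //; exists [ffun i => x i / r%:R] => //.
  by apply/ffunP => i; rewrite !ffunE -mulrSr.
exists r; rewrite (_ : x = [ffun i => x i / r%:R *+ r])//.
by apply/ffunP => i; rewrite ffunE -mulr_natr divfK// gt_eqF.
Qed.

(* [K i + 1] cells of length at most [eps i] cut the [i]-th circle, so among [h] targets
   two differ by a vector of [D], unless two points of the box contradict the packing
   hypothesis. *)
Theorem transfer_inhom :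
  (\prod_i (K i).+1 < h * \prod_j (b j).+1)%N ->
  (forall N : J -> int, (forall j, `|N j| <= b j)%N -> (exists j, N j != 0) ->
    exists i, eps i <= dist_int (lin N i)) ->
  forall g : I -> R, exists N : J -> int, (forall j, `|N j| <= h.*2 * b j)%N /\
    forall i, dist_int (lin N i - g i) <= h.*2%:R * eps i.
Proof.
move=> count pack g.
suff /sumset_bound[N [Nb Ng]] : sumset D h.*2 [ffun i => g i].
  by exists N; split=> // i; have := Ng i; rewrite ffunE.
apply: sumset_cover => // f.
(* Coordinates are taken in [[0, b j]], so that the difference of two such points satisfies the
   bounds in [D] and in [pack]. *)
pose val_ (n : {dffun forall j, 'I_(b j).+1}) j : int := (n j : nat)%:Z.
pose c (p : 'I_h * {dffun forall j, 'I_(b j).+1}) :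
    {dffun forall i, 'I_(K i).+1} :=
  [ffun i => cell (K i) (lin (val_ p.2) i - f p.1 i)].
have [[s n] [[s' n'] [ne e]]] : exists p q, p != q /\ c p = c q.
  by apply: pigeonhole; rewrite card_prod !card_box card_ord.
have close i : dist_int (lin (fun j => val_ n j - val_ n' j) i - (f s - f s') i)
    < eps i.
  apply: lt_le_trans (Keps i); rewrite linB !ffunE.
  rewrite (_ : _ - _ = lin (val_ n) i - f s i - (lin (val_ n') i - f s' i));
    last by ring.
  by apply: dist_int_cell; move/ffunP: e => /(_ i); rewrite !ffunE.
have small j : (`|(val_ n j - val_ n' j)%R| <= b j)%N.
  have := ltn_ord (n j); have := ltn_ord (n' j); rewrite /val_.
  by move: (n j : nat) (n' j : nat) => p q; lia.
have [es|ss] := eqVneq s s'; last first.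
  by exists s, s'; split=> //; exists (fun j => val_ n j - val_ n' j).
have nn : n != n' by apply: contraNneq ne => ->; rewrite es.
case: (pack _ small) => [|i le_i].
  apply: contrapT => /forallNP all0; move/eqP: nn; apply; apply/ffunP => j.
  by apply/val_inj; have /negP := all0 j; rewrite negbK subr_eq0 => /eqP [].
by have := close i; rewrite es subrr ffunE subr0 ltNge le_i.
Qed.

End Transfer.

(** * Linear forms and simultaneous approximation *)

Section Transference.
Variables (R : realType) (J : finType) (Q : pred J) (alpha : J -> R).

Definition simult_bad (c : R) := forall n : nat, (0 < n)%N ->
  c <= n%:R * \prod_(j | Q j) dist_int (n%:R * alpha j).

Definition linear_bad (c : R) := forall N : J -> int,
  (exists2 j, Q j & N j != 0) ->
  c <= dist_int (\sum_(j | Q j) (N j)%:~R * alpha j) *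
       (\prod_(j | Q j) maxn 1 `|N j|)%:R.

(** [transfer_inhom] for a single form: with [P] the product of the [b j + 1], [linear_bad] gives
    the separation [c / P], and the cells, at most [P / c + 1 <= P (1 / c + 1)] in number, are fewer
    than [h P]. Hence [r = 2h] depends on [c] only. *)
Lemma inhom_linear (c : R) : 0 < c -> linear_bad c ->
  exists2 r : nat, (0 < r)%N & forall (b : J -> nat) (g : R),
    exists N : J -> int,
    [/\ forall j, Q j -> (`|N j| <= r * b j)%N,
        forall j, ~~ Q j -> N j = 0
      & dist_int (\sum_(j | Q j) (N j)%:~R * alpha j - g) <=
        r%:R * (c / (\prod_(j | Q j) (b j).+1)%:R)].
Proof.
move=> c0 bad; pose h := (Num.truncn c^-1).+2.
have hc : c^-1 + 1 < h%:R.
  by rewrite /h -[X in _ < X]natr1 ltrD2r truncnS_gt.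
exists h.*2 => [|b g]; first by rewrite double_gt0.
set P := (\prod_(j | Q j) (b j).+1)%N.
have P1 : 1 <= P%:R :> R by rewrite ler1n prodn_gt0.
(* A zero bound off the block makes those coordinates of [N] vanish. *)
pose b' j := if Q j then b j else 0%N.
have EP : (\prod_j (b' j).+1 = P)%N.
  by rewrite /P [RHS]big_mkcond; apply: eq_bigr => j _; rewrite /b'; case: ifP.
have linE (N : J -> int) : (forall j, ~~ Q j -> N j = 0) ->
    lin (fun j (_ : unit) => alpha j) N tt = \sum_(j | Q j) (N j)%:~R * alpha j.
  move=> N0; rewrite /lin [RHS]big_mkcond; apply: eq_bigr => j _.
  by case: ifPn => // /N0 ->; rewrite mul0r.
have supp m (N : J -> int) : (forall j, `|N j| <= m * b' j)%N ->
    forall j, ~~ Q j -> N j = 0.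
  move=> Nb j nQ; have := Nb j; rewrite /b' (negbTE nQ) muln0 leqn0 absz_eq0.
  by move/eqP.
pose K := Num.truncn (P%:R / c).
have Pc0 : 0 <= P%:R / c by rewrite divr_ge0// ltW.
have /andP[K1 K2] := truncn_itv Pc0.
have [] := @transfer_inhom R unit J (fun j _ => alpha j) b' (fun=> K)
  (fun=> c / P%:R) h _ _ _ (fun=> g).
- by move=> _; rewrite -[leRHS]invf_div lef_pV2 ?posrE ?ltr0n ?divr_gt0 ?ltr0n//
    ?ltW// prodn_gt0.
- rewrite EP (bigD1 tt)//= big1 ?muln1; last by case.
  rewrite -(ltr_nat R) natrM -natr1.
  apply: (@le_lt_trans _ _ (P%:R * (c^-1 + 1))); last by rewrite mulrC ltr_pM2r//; lra.
  by rewrite mulrDr mulr1; apply: lerD.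
- move=> N Nb [j Nj]; exists tt.
  have N0 := supp 1%N N (fun j => eq_ind_r (leq _) (Nb j) (mul1n _)).
  have Qj : Q j by apply: contraNT Nj => /N0 ->.
  rewrite linE// ler_pdivrMr; last by lra.
  apply: le_trans (bad N (ex_intro2 _ _ j Qj Nj)) _.
  apply: ler_wpM2l; first exact: dist_int_ge0.
  rewrite ler_nat; apply: leq_prod => i Qi; have := Nb i; rewrite /b' Qi; lia.
move=> N [Nb Ng]; exists N; have N0 := supp _ _ Nb; split=> //.
  by move=> j Qj; have := Nb j; rewrite /b' Qj.
by rewrite -linE//; exact: Ng tt.
Qed.

(** The obstruction behind both transference theorems: a number forced near an integer cannot also
    be near a half-integer. *)
Let dist_int_half_int (z : int) (t : R) :
  dist_int (z%:~R + t - 2^-1) >= 2^-1 - `|t|.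
Proof.
apply: dist_int_ge => w; rewrite lerBlDr.
have -> : z%:~R + t - 2^-1 - w%:~R = (z - w)%:~R - 2^-1 + t by rewrite intrB; ring.
have half : 2^-1 <= `|(z - w)%:~R - 2^-1| :> R.
  rewrite ler_normr; have [le0|ge1] := leP (z - w) 0.
    have : (z - w)%:~R <= 0 :> R by rewrite lerz0.
    by move=> ?; apply/orP; right; lra.
  have : 1 <= (z - w)%:~R :> R by rewrite -[1]/(1%:~R) ler_int; lia.
  by move=> ?; apply/orP; left; lra.
apply: le_trans half _; rewrite -{1}[_ - 2^-1](addrK t) .
exact: ler_normB.
Qed.

Let sum_near_int (N p : J -> int) (x t : J -> R) :
  (forall j, x j = (p j)%:~R + t j) ->
  \sum_(j | Q j) (N j)%:~R * x j =
    (\sum_(j | Q j) N j * p j)%:~R + \sum_(j | Q j) (N j)%:~R * t j.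
Proof.
move=> xpt; rewrite (raddf_sum (intmul 1)) -big_split /=.
by apply: eq_bigr => j _; rewrite xpt mulrDr intrM.
Qed.

(** Given [n], choose [N] with [|N j|] at most of order [1 / dist_int (n alpha_j)] and [N . alpha]
    close to [1 / (2n)]. Then [n (N . alpha)] is within [n r c / P] of 1/2 modulo 1 and within 1/4
    of an integer, so [n r c / P >= 1/4]. This bounds [P] from above, hence the product of the
    distances from below. *)
Theorem simult_of_linear :
  (exists2 c, 0 < c & linear_bad c) -> exists2 c, 0 < c & simult_bad c.
Proof.
move=> [c c0 bad]; have [r r0 inhom] := inhom_linear c0 bad.
have rR : 1 <= r%:R :> R by rewrite ler1n.
(* [kap] makes [q] terms of size at most [r kap] add up to at most 1/4. *)
pose q := #|Q|; pose kap : R := (4 * r%:R * q.+1%:R)^-1.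
have q1 : 1 <= q.+1%:R :> R by rewrite ler1n.
have kap0 : 0 < kap by rewrite invr_gt0; nra.
have d0 n j : (0 < n)%N -> Q j -> 0 < dist_int (n%:R * alpha j).
  move=> n0 Qj; rewrite lt_neqAle dist_int_ge0 andbT eq_sym; apply/eqP => dj.
  have := bad (fun i => if i == j then n%:Z else 0) _.
  rewrite (bigD1 j)//= eqxx big1 => [|i /andP[_ /negbTE ->]]; last by rewrite mul0r.
  rewrite addr0 dj mul0r => h; move: c0; rewrite ltNge => /negP; apply; apply: h.
  by exists j => //; rewrite eqxx; lia.
exists (kap ^+ q / (4 * r%:R * c)) => [|n n0].
  by rewrite divr_gt0 ?exprn_gt0//; nra.
have nR : 0 < n%:R :> R by rewrite ltr0n.
pose b j := Num.truncn (kap / dist_int (n%:R * alpha j)).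
have [N [Nb _ close]] := inhom b (2^-1 / n%:R).
have /choice [p pP] := fun j => dist_int_nearest (n%:R * alpha j).
set P := (\prod_(j | Q j) (b j).+1)%N in close.
have P0 : 0 < P%:R :> R by rewrite ltr0n prodn_gt0.
set S := \sum_(j | Q j) (N j)%:~R * alpha j in close.
set t := \sum_(j | Q j) (N j)%:~R * (n%:R * alpha j - (p j)%:~R).
have nS : n%:R * S = (\sum_(j | Q j) N j * p j)%:~R + t.
  rewrite -(@sum_near_int N p (fun j => n%:R * alpha j)); last by move=> j; ring.
  by rewrite mulr_sumr; apply: eq_bigr => j _; ring.
have t4 : `|t| <= 4^-1.
  apply: le_trans (ler_norm_sum _ _ _) _.
  have le_j j : Q j -> `|(N j)%:~R * (n%:R * alpha j - (p j)%:~R)| <= r%:R * kap.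
    move=> Qj; rewrite normrM -pP -intr_norm -abszE.
    have dj := d0 _ _ n0 Qj.
    apply: (@le_trans _ _ ((r * b j)%:R * dist_int (n%:R * alpha j))).
      by rewrite ler_pM2r// -[leLHS]/(`|N j|%:R) ler_nat Nb.
    rewrite natrM -mulrA ler_pM2l; last by lra.
    rewrite -ler_pdivlMr//.
    by have /andP[] := truncn_itv (ltW (divr_gt0 kap0 dj)).
  apply: le_trans (ler_sum _ le_j) _.
  rewrite sumr_const -/q -[leLHS]mulr_natr /kap.
  rewrite [leLHS](_ : _ = 4^-1 * (q%:R / q.+1%:R)); last by field; lra.
  rewrite ler_piMr// ler_pdivrMr; last by lra.
  by rewrite mul1r ler_nat.
have far := dist_int_half_int (\sum_(j | Q j) N j * p j) t.
have near : dist_int (n%:R * S - 2^-1) <= n%:R * (r%:R * (c / P%:R)).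
  rewrite (_ : _ - _ = n%:R * (S - 2^-1 / n%:R)); last by field; lra.
  by apply: le_trans (dist_intMn _ _) _; rewrite ler_pM2l.
rewrite nS in near.
have : 4^-1 <= n%:R * (r%:R * (c / P%:R)) by lra.
rewrite (_ : _ * _ = 4^-1 * ((4 * n%:R * r%:R * c) / P%:R)); last by field; lra.
rewrite ler_pMr ?invr_gt0// ler_pdivlMr// mul1r => PP.
rewrite ler_pdivrMr; last by nra.
have kP : kap ^+ q <= P%:R * \prod_(j | Q j) dist_int (n%:R * alpha j).
  rewrite /q -prodr_const /P natr_prod -big_split /=.
  apply: ler_prod => j Qj; rewrite (ltW kap0)/= -ler_pdivrMr ?d0//.
  have /andP[_ /ltW] := truncn_itv (ltW (divr_gt0 kap0 (d0 _ _ n0 Qj))).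
  exact.
apply: le_trans kP _.
rewrite (_ : _ * (4 * _ * _) = (4 * n%:R * r%:R * c) *
  \prod_(j | Q j) dist_int (n%:R * alpha j)); last by ring.
by apply: ler_wpM2r => //; apply: prodr_ge0 => j _; exact: dist_int_ge0.
Qed.

(** The dual argument, with one integer variable [z] and the forms [z alpha_j]. The target [g]
    satisfies [N . g = 1/2]; approximating it within [r kap / M j] in each coordinate of the block
    puts [z S] within 1/4 of a half-integer. So [|z| dist_int S >= 1/4], while [|z| <= r c / E]. *)
Theorem linear_of_simult :
  (exists2 c, 0 < c & simult_bad c) -> exists2 c, 0 < c & linear_bad c.
Proof.
move=> [c c0 bad]; pose q := #|Q|; pose h := (Num.truncn (2 ^+ q / c)).+1.
have hc : 2 ^+ q / c < h%:R by rewrite truncnS_gt.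
pose r := h.*2; have rR : 1 <= r%:R :> R by rewrite ler1n double_gt0.
pose kap : R := (4 * r%:R * q.+1%:R)^-1.
have q1 : 1 <= q.+1%:R :> R by rewrite ler1n.
have kap0 : 0 < kap by rewrite invr_gt0; nra.
have kap1 : kap <= 1 by rewrite invf_le1; nra.
exists (kap ^+ q / (4 * r%:R * c)) => [|N [j0 Qj0 Nj0]].
  by rewrite divr_gt0 ?exprn_gt0//; nra.
pose M j : R := (maxn 1 `|N j|)%:R.
have M1 j : 1 <= M j by rewrite ler1n leq_max.
have Mgt0 j : 0 < M j by have := M1 j; lra.
pose eps j : R := if Q j then kap / M j else 1.
pose K j := if Q j then Num.truncn (M j / kap) else 0%N.
pose E := \prod_(j | Q j) (kap / M j).
have E0 : 0 < E by apply: prodr_gt0 => j _; rewrite divr_gt0.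
have PM0 : 0 < \prod_(j | Q j) M j by exact: prodr_gt0.
have EM : E * \prod_(j | Q j) M j = kap ^+ q.
  rewrite /E -big_split /= /q -prodr_const; apply: eq_bigr => j _.
  by rewrite divfK// gt_eqF.
pose b := Num.truncn (c / E).
have cE0 : 0 <= c / E by rewrite divr_ge0// ltW.
have /andP[b1 b2] := truncn_itv cE0; rewrite -/b in b1 b2.
have linE (m : unit -> int) i :
    lin (fun (_ : unit) => alpha) m i = (m tt)%:~R * alpha i.
  by rewrite /lin (bigD1 tt)//= big1 ?addr0//; case.
have dist_abs (z : int) x : dist_int (z%:~R * x) = dist_int (`|z|%:R * x : R).
  by case: (intP z) => [|n|n]; rewrite ?intrN ?mulNr ?dist_intN ?abszN.
pose g i : R := if i == j0 then 2^-1 / (N j0)%:~R else 0.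
have [] := @transfer_inhom R J unit (fun _ => alpha) (fun=> b) K eps h _ _ _
  (fun i => if i == j0 then 2^-1 / (N j0)%:~R else 0).
- move=> j; rewrite /K /eps; case: ifP => _; last by rewrite invr1.
  rewrite -[leRHS]invf_div lef_pV2 ?posrE ?ltr0n ?divr_gt0//.
  by rewrite ltW// truncnS_gt.
(* Since [M j / kap >= 1], each [K j + 1] on the block is at most [2 M j / kap]; this is the source
   of [2 ^ q] in [h]. *)
- rewrite -(ltr_nat R) natrM (bigD1 tt)//= [X in (_ * X)%N]big1 ?muln1; last by case.
  apply: (@le_lt_trans _ _ (2 ^+ q / E)).
    rewrite natr_prod (bigID Q) /= [X in _ * X]big1 => [|j nQ]; last first.
      by rewrite /K (negbTE nQ).
    rewrite mulr1 /E -prodfV /q -prodr_const -big_split /=.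
    apply: ler_prod => j Qj; rewrite ler0n /K Qj /= invf_div.
    have Mk : 1 <= M j / kap by rewrite ler_pdivlMr// mul1r (le_trans kap1).
    have Tk : (Num.truncn (M j / kap))%:R <= M j / kap by rewrite truncn_le; lra.
    by rewrite -natr1; lra.
  rewrite ltr_pdivrMr//; rewrite ltr_pdivrMr// in b2.
  rewrite ltr_pdivrMr// in hc.
  apply: lt_le_trans hc _; rewrite -mulrA ler_pM2l ?ltr0n// ltW//.
(* A nonzero [m tt] of size at most [b] with all forms below [eps] would make the product in
   [simult_bad] less than [b E <= c]; strictness comes from [j0] being in the block. *)
- move=> m mb [[] m0]; apply: contrapT => /forallNP small.
  have n0 : (0 < `|m tt|)%N by rewrite absz_gt0.
  have := bad _ n0; rewrite leNgt => /negP; apply.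
  apply: (@lt_le_trans _ _ (`|m tt|%:R * E)); last first.
    rewrite -ler_pdivlMr//; apply: le_trans b1; rewrite ler_nat; exact: mb.
  rewrite ltr_pM2l ?ltr0n// /E; apply: ltr_prod; first by apply/hasP; exists j0.
  move=> j Qj; rewrite dist_int_ge0/=.
  have := small j; rewrite /eps Qj linE dist_abs.
  by move/negP; rewrite -ltNge.
move=> m [mb mg]; pose z := m tt.
have mz i : dist_int (z%:~R * alpha i - g i) <= r%:R * eps i.
  by have := mg i; rewrite linE.
have /choice [p pP] := fun j => dist_int_nearest (z%:~R * alpha j - g j).
set S := \sum_(j | Q j) (N j)%:~R * alpha j.
have [w wP] := dist_int_nearest S.
pose t j := z%:~R * alpha j - g j - (p j)%:~R.
pose T := \sum_(j | Q j) (N j)%:~R * t j.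
have T4 : `|T| <= 4^-1.
  apply: le_trans (ler_norm_sum _ _ _) _.
  have le_j j : Q j -> `|(N j)%:~R * t j| <= r%:R * kap.
    move=> Qj; rewrite normrM /t -pP -intr_norm -abszE.
    apply: (@le_trans _ _ (M j * (r%:R * eps j))).
      apply: ler_pM => //; first exact: dist_int_ge0.
      by rewrite -[leLHS]/(`|N j|%:R) ler_nat leq_maxr.
    by rewrite /eps Qj mulrCA [_ * (kap / _)]mulrC divfK// gt_eqF.
  apply: le_trans (ler_sum _ le_j) _.
  rewrite sumr_const -/q -[leLHS]mulr_natr /kap.
  rewrite [leLHS](_ : _ = 4^-1 * (q%:R / q.+1%:R)); last by field; lra.
  rewrite ler_piMr// ler_pdivrMr; last by lra.
  by rewrite mul1r ler_nat.
have zS : z%:~R * S = (\sum_(j | Q j) N j * p j)%:~R + (2^-1 + T).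
  have -> : 2^-1 + T = \sum_(j | Q j) (N j)%:~R * (g j + t j).
    rewrite /T; under [RHS]eq_bigr do rewrite mulrDr.
    rewrite big_split /=; congr (_ + _).
    rewrite (bigD1 j0)//= /g eqxx big1 => [|i /andP[_ /negbTE ->]].
      by rewrite addr0 mulrC divfK// intr_eq0.
    by rewrite mulr0.
  rewrite -(@sum_near_int N p (fun j => z%:~R * alpha j)).
    by rewrite mulr_sumr; apply: eq_bigr => j _; ring.
  by move=> j; rewrite /t; ring.
(* The point tested turns out to be 0, so the bound says that [|z (S - w) - T|] is at least 1/2. *)
have := dist_int_half_int (z * w - \sum_(j | Q j) N j * p j)
  (z%:~R * (S - w%:~R) - T).
rewrite intrB intrM.
rewrite (_ : _ - 2^-1 = z%:~R * S - (\sum_(j | Q j) N j * p j)%:~R - (2^-1 + T));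
  last by ring.
rewrite zS [X in dist_int X](_ : _ = 0); last by ring.
rewrite dist_int_small normr0 ?invr_ge0//.
move=> far; have {far} : 4^-1 <= `|z%:~R * (S - w%:~R)|.
  by have := ler_normB (z%:~R * (S - w%:~R)) T; lra.
rewrite normrM -wP -intr_norm -abszE => far.
have zb : (`|z|)%:~R <= r%:R * (c / E).
  apply: (@le_trans _ _ (r * b)%:R); first by rewrite -[leLHS]/(`|z|%:R) ler_nat; exact: mb.
  by rewrite natrM ler_pM2l//; lra.
have {far zb} : 4^-1 <= r%:R * (c / E) * dist_int S.
  by apply: le_trans far _; apply: ler_wpM2r zb; exact: dist_int_ge0.
rewrite ler_pdivrMr; last by nra.
rewrite natr_prod -EM (_ : r%:R * (c / E) * dist_int S = r%:R * c * dist_int S / E);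
  last by field; lra.
rewrite ler_pdivlMr// => far.
by rewrite -/M mulrAC ler_pM2r//; lra.
Qed.

End Transference.

(** * The liminf condition and its block form *)

Section Liminf.
Variable R : realType.

(** The liminf is the supremum of the tail infima, so it is positive exactly when some tail infimum
    is. *)
Lemma limn_einf_gt0 (u : nat -> R) :
  (0%:E < limn_einf (fun n => (u n)%:E))%E <->
  exists c : R, 0 < c /\ exists n0, forall n, (n0 <= n)%N -> c <= u n.
Proof.
rewrite limn_einf_lim (cvg_lim _ (@cvg_einfs_sup _ (fun n => (u n)%:E)))//; split.
  move=> /ereal_sup_gt[_ [n _ <-]]; rewrite {1}/einfs /= => inf0.
  have le_u k : (n <= k)%N ->
      (ereal_inf (sdrop (fun n => (u n)%:E) n) <= (u k)%:E)%E.
    by move=> nk; apply: ereal_inf_lbound; exists k.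
  case E : (ereal_inf _) inf0 le_u => [c||] //= c0 le_u; last first.
    by have := le_u n (leqnn n); rewrite leye_eq.
  exists c; split; first by rewrite lte_fin in c0.
  by exists n => k /le_u; rewrite lee_fin.
move=> [c [c0 [n0 cu]]].
apply: (@lt_le_trans _ _ (einfs (fun n => (u n)%:E) n0)); last first.
  by apply: ereal_sup_ubound; exists n0.
apply: (@lt_le_trans _ _ c%:E); first by rewrite lte_fin.
by apply: le_ereal_inf_tmp => _ [k /= n0k <-]; rewrite lee_fin cu.
Qed.

(* A single [n] with a small product would make the products along its multiples small. *)
Lemma mult_liminf_gt0 (m : nat) (alpha : 'I_m -> R) :
  (0%:E < mult_liminf alpha)%E <-> exists2 c, 0 < c & simult_bad predT alpha c.
Proof.
rewrite /mult_liminf limn_einf_gt0; split=> [[c [c0 [n0 cu]]]|[c c0 bad]]; last first.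
  by exists c; split=> //; exists 0%N => n _; exact: bad.
have p0 : 0 < n0.+1%:R ^+ m.+1 :> R by rewrite exprn_gt0// ltr0n.
(* The multiple [n (n0 + 1)] lies in the tail; passing to it multiplies the leading factor by
   [n0 + 1] and each of the [m] distances by at most that. The predecessor in [nn] undoes the index
   shift. *)
exists (c / n0.+1%:R ^+ m.+1) => [|n n_gt0]; first exact: divr_gt0.
rewrite ler_pdivrMr//; have nn : (n0 <= (n * n0.+1).-1)%N by nia.
have := cu _ nn; rewrite /= prednK ?muln_gt0 ?n_gt0// => /le_trans; apply.
rewrite natrM -!mulrA ler_pM2l ?ltr0n// exprS mulrCA ler_pM2l ?ltr0n//.
rewrite -[X in n0.+1%:R ^+ X](card_ord m) -prodr_const -big_split /=.
apply: ler_prod => j _; rewrite dist_int_ge0/=.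
rewrite (_ : _ * _ * _ = n0.+1%:R * (n%:R * alpha j)); last by ring.
by rewrite [leRHS]mulrC; exact: dist_intMn.
Qed.

Lemma simult_bad_reindex (I J : finType) (Q : pred J) (h : I -> J)
    (alpha : J -> R) (c : R) :
  injective h -> (forall j, Q j <-> exists i, h i = j) ->
  simult_bad Q alpha c <-> simult_bad predT (alpha \o h) c.
Proof.
move=> inj Qh.
suff E n : \prod_(j | Q j) dist_int (n%:R * alpha j) =
    \prod_i dist_int (n%:R * alpha (h i)).
  by split=> bad n n0; have := bad n n0; rewrite E.
rewrite -(big_imset (fun j => dist_int (n%:R * alpha j)) (in2W inj)) /=.
apply: eq_bigl => j; apply/idP/imsetP.
  by move/Qh => [i <-]; exists i.
by move=> [i _ ->]; apply/Qh; exists i.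
Qed.

(* [a] lists the numbers [alpha_ij] and [b] sends the place of [alpha_ij] to [i]. *)
Lemma condition_blocks (d e : nat) :
  (exists m : 'I_e -> nat,
      [/\ forall i, (0 < m i)%N,
          d = (\sum_(i < e) m i)%N
        & forall i, exists alpha : 'I_(m i) -> R, (0%:E < mult_liminf alpha)%E])
  <->
  (exists (a : 'I_d -> R) (b : 'I_d -> 'I_e),
      (forall i, exists j, b j = i) /\
      forall i, exists2 c, 0 < c & simult_bad (fun j => b j == i) a c).
Proof.
split.
  move=> [m [m0 -> bad]].
  have {}bad i : {alpha : 'I_(m i) -> R | exists2 c, 0 < c & simult_bad predT alpha c}.
    by apply: cid; have [alpha /mult_liminf_gt0] := bad i; exists alpha.
  pose al (p : {i & 'I_(m i)}) : R := sval (bad (tag p)) (tagged p).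
  exists (al \o tagnat.sig), tagnat.sig1; split=> i.
    by exists (tagnat.Rank i (Ordinal (m0 i))); rewrite tagnat.Rank1K.
  have [c c0 badc] := svalP (bad i); exists c => //.
  apply/(@simult_bad_reindex _ _ _ (tagnat.Rank i)).
  - by move=> l l' /(congr1 val) /eqP; rewrite tagnat.eq_Rank eqxx => /eqP/val_inj.
  - move=> j; split=> [/eqP <-|[l <-]]; last by rewrite tagnat.Rank1K.
    by exists (tagnat.sig2 j); exact: tagnat.sig2K.
  rewrite (_ : _ \o _ = sval (bad i))//.
  by apply/funext => l; rewrite /comp /tagnat.Rank tagnat.rankK.
move=> [a [b [surj bad]]].
exists (fun i => #|[pred j | b j == i]|); split=> [i||i].
- by have [j bj] := surj i; apply/card_gt0P; exists j; rewrite inE bj.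
- rewrite -[LHS]card_ord -sum1_card (partition_big b predT)//=.
  by apply: eq_bigr => i _; rewrite sum1_card.
have [c c0 badc] := bad i; exists (a \o enum_val); apply/mult_liminf_gt0.
exists c => //; apply/(@simult_bad_reindex _ _ (fun j => b j == i)) => //.
  exact: enum_val_inj.
move=> j; split=> [bj|[l <-]]; last by have := enum_valP l; rewrite inE.
have jA : j \in [pred j | b j == i] by rewrite inE.
by exists (enum_rank_in jA j); rewrite enum_rankK_in.
Qed.

End Liminf.

(** * Phases and box repetitivity *)

Section Frac.
Variable R : realType.
Implicit Types x y l : R.

Definition frac x : R := x - (Num.floor x)%:~R.

Lemma frac_itv x : 0 <= frac x < 1.
Proof.
have := floor_itv x; rewrite intrD /frac => /andP[f0 f1].
by rewrite subr_ge0 f0 ltrBlDl.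
Qed.

Lemma frac_unique x (z : int) : 0 <= x - z%:~R < 1 -> frac x = x - z%:~R.
Proof.
move=> /andP[x0 x1]; rewrite /frac (_ : Num.floor x = z)//.
by apply: floor_def; rewrite intrD -subr_ge0 x0 -ltrBlDl.
Qed.

Lemma dist_int_fracE x : dist_int (frac x) = dist_int x.
Proof. by rewrite /frac -intrN dist_intDz. Qed.

Lemma frac_near x m r :
  dist_int (x - m) < r -> 0 <= m - r -> m + r <= 1 -> m - r < frac x < m + r.
Proof.
have [z ->] := dist_int_nearest (x - m); rewrite ltr_norml => /andP[h1 h2] mr0 mr1.
have -> : frac x = x - z%:~R by apply: frac_unique; apply/andP; split; lra.
by apply/andP; split; lra.
Qed.

(** This is how floors encode cells: for a phase [x] in [[0, 1)], the floor of [x - l] records on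
    which side of the cut [frac l] it lies. *)
Lemma floor_frac_lt x l : (Num.floor (x - l) < - Num.floor l) = (x < frac l).
Proof. by rewrite floor_lt_int intrN /frac ltrBlDr addrC. Qed.

Lemma dist_int_fracP l :
  (dist_int l = frac l /\ frac l <= 2^-1) \/
  (dist_int l = 1 - frac l /\ 2^-1 <= frac l).
Proof.
have /andP[l0 l1] := frac_itv l; rewrite -dist_int_fracE.
have [le|gt] := leP (frac l) 2^-1.
  by left; rewrite dist_int_small ger0_norm.
right; split; last exact: ltW.
rewrite -(dist_intDz (frac l) (-1)) (_ : _ + _ = - (1 - frac l)); last by ring.
by rewrite dist_intN dist_int_small ger0_norm//; lra.
Qed.

(* [p] is the midpoint and the half-length of the shorter arc between [0] and [l]. *)
Lemma short_arc l : 0 < dist_int l -> exists p : R * R, 0 < p.2 /\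
  forall x y, dist_int (x - p.1) < p.2 ->
    Num.floor (frac x - l) = Num.floor (frac y - l) -> dist_int y <= dist_int l.
Proof.
move=> l_gt0; have /andP[l0 l1] := frac_itv l.
have [[E l2]|[E l2]] := dist_int_fracP l; rewrite E in l_gt0 *.
  exists (frac l / 2, frac l / 2) => /=; split=> [|x y /frac_near near same].
    by rewrite divr_gt0.
  have /andP[x0 x1] : frac l / 2 - frac l / 2 < frac x < frac l / 2 + frac l / 2.
    by apply: near; lra.
  have : frac y < frac l by rewrite -floor_frac_lt -same floor_frac_lt; lra.
  have /andP[y0 _] := frac_itv y.
  rewrite -[dist_int y]dist_int_fracE => yl.
  by apply: le_trans (dist_int_le _ 0) _; rewrite subr0 ger0_norm// ltW.
exists ((1 + frac l) / 2, (1 - frac l) / 2) => /=.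
split=> [|x y /frac_near near same]; first by rewrite divr_gt0.
have /andP[x0 x1] : (1 + frac l) / 2 - (1 - frac l) / 2 < frac x
    < (1 + frac l) / 2 + (1 - frac l) / 2 by apply: near; lra.
have : frac l <= frac y.
  by rewrite leNgt -floor_frac_lt -same floor_frac_lt -leNgt; lra.
have /andP[_ y1] := frac_itv y.
rewrite -[dist_int y]dist_int_fracE => yl.
apply: le_trans (dist_int_le _ 1) _; rewrite distrC ger0_norm ?subr_ge0 ?(ltW y1)//.
by lra.
Qed.

Lemma dist_int_ratio (k : int) (q : nat) : (`|k| < q)%N ->
  dist_int (k%:~R / q%:R : R) < q%:R^-1 -> k = 0.
Proof.
move=> kq; have q0 : 0 < q%:R :> R by rewrite ltr0n; apply: leq_ltn_trans kq.
have [z ->] := dist_int_nearest (k%:~R / q%:R : R).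
have -> : k%:~R / q%:R - z%:~R = (k - z * q%:Z)%:~R / q%:R :> R.
  by rewrite intrB intrM mulrBl [_ * _ / _]mulfK ?gt_eqF.
rewrite normrM normfV normr_nat -[ltRHS]mul1r ltr_pM2r ?invr_gt0//.
rewrite -intr_norm -[1]/(1%:~R) ltr_int.
by move=> h; have z0 : z = 0; nia.
Qed.

(** Two of the [m + 1] multiples [0, x, ..., m x] fall into the same of [m] arcs. *)
Lemma dirichlet x (m : nat) : (0 < m)%N ->
  exists t : nat, (0 < t <= m)%N /\ dist_int (t%:R * x) <= m%:R^-1.
Proof.
case: m => // m _.
have [|s [t [st e]]] := @pigeonhole 'I_m.+2 'I_m.+1 (fun s => cell m (s%:R * x)).
  by rewrite !card_ord.
wlog lt_st : s t st e / (s < t)%N.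
  move=> H; have [lt|lt|/val_inj eq] := ltngtP s t; first exact: (H s t).
    by apply: (H t s) => //; rewrite eq_sym.
  by rewrite eq eqxx in st.
exists (t - s)%N; split.
  by move: (ltn_ord t) lt_st; move: (s : nat) (t : nat) => p q; lia.
rewrite natrB ?(ltnW lt_st)// mulrBl; apply/ltW/dist_int_cell; exact/esym.
Qed.

End Frac.

Section Repetitivity.
Variables (R : realType) (d e : nat) (M : 'I_d -> 'I_e -> R).
Variables (c : 'I_e -> R) (u : 'I_d -> R) (T : 'I_e -> 'I_d -> R).

(* The point of the window below the lattice point over [n]. *)
Definition phase (n : 'I_d -> int) (i : 'I_e) : R := frac (c i - lin M n i).

Definition in_box (lo hi n : 'I_d -> int) := forall j, lo j <= n j <= hi j.

(** The floor is minus the increment of the height from [n] to [n + N] (see [height_step]), so its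
    equality over the box says that the two patches are translates of each other. *)
Definition same_pattern (lo hi n n' : 'I_d -> int) := forall N, in_box lo hi N ->
  forall i, Num.floor (phase n i - lin M N i) = Num.floor (phase n' i - lin M N i).

Definition orbit_dense := forall (g eps : 'I_e -> R), (forall i, 0 < eps i) ->
  exists n, forall i, dist_int (lin M n i - g i) < eps i.

(** LR_Omega for integral rectangles containing the origin, in coordinates: the point of [Y] over
    [n] has first [d] coordinates [n + u + phase n T], where [u] comes from the shift and [T] from
    the direction of F_pi. *)
Definition box_repetitive := exists2 C : R, 0 < C &
  forall lo hi : 'I_d -> int, (forall j, lo j <= 0 <= hi j /\ lo j < hi j) ->
  forall (n0 : 'I_d -> int) (t : 'I_d -> R), exists n : 'I_d -> int,
    (forall j, t j + C * (lo j)%:~R <=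
       (n j)%:~R + u j + \sum_i phase n i * T i j <= t j + C * (hi j)%:~R) /\
    same_pattern lo hi n n0.

Lemma phase_shift_le n j : `|\sum_i phase n i * T i j| <= \sum_i \sum_j `|T i j|.
Proof.
apply: le_trans (ler_norm_sum _ _ _) _; apply: ler_sum => i _.
have /andP[p0 p1] := frac_itv (c i - lin M n i).
rewrite normrM ger0_norm// (bigD1 j)//= -[leLHS]addr0; apply: lerD.
  by rewrite ler_piMl// ltW.
exact: sumr_ge0.
Qed.

(* The points whose phase lies in a product of arcs of lengths about [1 / q i] recur
   within the dilated box; by density its translates reach [\prod_i q i] separated
   phases, so the dilated box has at least that many lattice points. *)
Lemma box_volume_bound : orbit_dense -> box_repetitive ->
  exists2 B : nat, (0 < B)%N &
  forall lo hi : 'I_d -> int, (forall j, lo j <= 0 <= hi j /\ lo j < hi j) ->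
  forall q : 'I_e -> nat, (forall i, q i = 1%N \/ (0 < q i)%N /\
    exists N, [/\ in_box lo hi N, 0 < dist_int (lin M N i) &
      4 * (q i)%:R * dist_int (lin M N i) <= 1]) ->
  (\prod_i q i <= \prod_j (B * `|(hi j - lo j)%R|))%N.
Proof.
move=> dense [C C0 rep]; pose tau : R := \sum_i \sum_j `|T i j|.
have tau0 : 0 <= tau by apply: sumr_ge0 => i _; apply: sumr_ge0.
have shift_le n j : `|\sum_i phase n i * T i j| <= tau by exact: phase_shift_le.
(* [C] times the side, plus [tau] at either end for the phase term, plus 1 for the floor in
   [base]. *)
pose B := (Num.truncn (C + 2 * tau + 1)).+1.
have hB : C + 2 * tau + 1 < B%:R by rewrite truncnS_gt.
exists B => // lo hi lohi q qP.
have q0 i : (0 < q i)%N by case: (qP i) => [->|[]].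
have /choice[mr mrP] : forall i, exists p : R * R, 0 < p.2 /\
    forall x y, dist_int (x - p.1) < p.2 ->
    (forall N, in_box lo hi N ->
      Num.floor (frac x - lin M N i) = Num.floor (frac y - lin M N i)) ->
    q i = 1%N \/ 4 * (q i)%:R * dist_int y <= 1.
  move=> i; case: (qP i) => [q1|[_ [N [Nbox N0 Nq]]]].
    by exists (0, 1); split=> //= x y _ _; left.
  have [p [p0 arc]] := short_arc N0; exists p; split=> // x y near same.
  right; apply: le_trans Nq; rewrite ler_pM2l; last by rewrite mulr_gt0 ?ltr0n.
  by apply: arc near _; exact: same.
(* The phases of [n0] lie in the short arcs, so every point with its pattern has its [i]-th phase
   within [1 / (4 q i)] of an integer wherever [q i] is not 1. *)
have [n0 n0P] := dense (fun i => c i - (mr i).1) (fun i => (mr i).2)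
  (fun i => proj1 (mrP i)).
have target n : same_pattern lo hi n n0 ->
    forall i, q i = 1%N \/ 4 * (q i)%:R * dist_int (c i - lin M n i) <= 1.
  move=> same i; have [_] := mrP i; apply; last first.
    by move=> N Nbox; exact/esym/same.
  rewrite (_ : _ - _ = - (lin M n0 i - (c i - (mr i).1))); last by ring.
  by rewrite dist_intN.
(* Density gives [v] with forms close to the grid point [g / q], and repetitivity a point [n] with
   the pattern of [n0] in the dilated box translated by [v]. The pair [p] keeps [n - v], counted
   from the corner [base], and [v]. *)
have spread (g : {dffun forall i, 'I_(q i)}) : exists p :
    {dffun forall j, 'I_(B * `|(hi j - lo j)%R|)} * ('I_d -> int),
    (forall i, dist_int (lin M p.2 i - (g i)%:R / (q i)%:R) < (8 * (q i)%:R)^-1) /\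
    forall i, q i = 1%N \/ 4 * (q i)%:R * dist_int (c i -
      lin M (fun j => p.2 j + (Num.floor (C * (lo j)%:~R - tau) + (p.1 j : nat)%:Z)) i) <= 1.
  have [|v vP] := dense (fun i => (g i)%:R / (q i)%:R) (fun i => (8 * (q i)%:R)^-1).
    by move=> i; rewrite invr_gt0 mulr_gt0 ?ltr0n.
  have [n [nP same]] := rep _ _ lohi n0 (fun j => (v j)%:~R + u j).
  pose base j := Num.floor (C * (lo j)%:~R - tau).
  have w_bound j : 0 <= n j - v j - base j /\
      (`|(n j - v j - base j)%R| < B * `|(hi j - lo j)%R|)%N.
    have /andP[n1 n2] := nP j; have [_ lt_lh] := lohi j.
    have := shift_le n j; rewrite ler_norml => /andP[s1 s2].
    have w0 : 0 <= n j - v j - base j.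
      rewrite subr_ge0 -ltzD1 /base floor_lt_int intrD intrB; lra.
    split=> //; rewrite -ltz_nat gez0_abs//.
    rewrite PoszM gez0_abs ?subr_ge0 ?ltW//.
    rewrite -(ltr_int R) intrM !intrB.
    have /andP[b1 b2] := floor_itv (C * (lo j)%:~R - tau).
    rewrite -/(base j) intrD in b1 b2.
    have D1 : 1 <= (hi j)%:~R - (lo j)%:~R :> R.
      by rewrite -intrB -[1]/(1%:~R) ler_int; lia.
    apply: (@lt_le_trans _ _ (C * ((hi j)%:~R - (lo j)%:~R) + 2 * tau + 1)); first lra.
    apply: (@le_trans _ _ ((C + 2 * tau + 1) * ((hi j)%:~R - (lo j)%:~R))); first nra.
    by rewrite ler_pM2r; [exact: ltW|lra].
  exists (finfun (fun j => Ordinal (proj2 (w_bound j))), v); split=> //= i.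
  have nE : n = (fun j => v j + (base j + `|(n j - v j - base j)%R|%:Z)).
    apply/funext => j; rewrite gez0_abs; last by case: (w_bound j).
    by ring.
  have := target _ same i; rewrite {1}nE; congr (_ \/ 4 * _ * dist_int (c i - _) <= 1).
  by apply: eq_bigr => j _; rewrite ffunE.
have /choice[F FP] := spread.
rewrite -(card_box q) -(card_box (fun j => B * `|(hi j - lo j)%R|)%N).
(* Equal displacements place the forms at the two [v] within [1 / (2 q i)] of each other modulo 1,
   hence the two grid points within [3 / (4 q i)], less than the grid step. *)
apply: (@leq_card _ _ (fun g => (F g).1)) => g g' eF.
apply/ffunP => i; apply/val_inj.
have [near arc] := FP g; have [near' arc'] := FP g'.
have [q1|q1] := eqVneq (q i) 1%N.
  move: (ltn_ord (g i)) (ltn_ord (g' i)) => /=.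
  by move: (g i : nat) (g' i : nat) => x y; rewrite q1; lia.
have qR : 0 < (q i)%:R :> R by rewrite ltr0n.
have {arc} arc : dist_int (c i - lin M (fun j => (F g).2 j +
   (Num.floor (C * (lo j)%:~R - tau) + ((F g).1 j : nat)%:Z)) i) <= (4 * (q i)%:R)^-1.
  case: (arc i) => [q1'|]; first by rewrite q1' eqxx in q1.
  by move=> h; rewrite -[leRHS]mul1r ler_pdivlMr ?mulr_gt0// mulrC.
have {arc'} arc' : dist_int (c i - lin M (fun j => (F g').2 j +
   (Num.floor (C * (lo j)%:~R - tau) + ((F g).1 j : nat)%:Z)) i) <= (4 * (q i)%:R)^-1.
  rewrite eF; case: (arc' i) => [q1'|]; first by rewrite q1' eqxx in q1.
  by move=> h; rewrite -[leRHS]mul1r ler_pdivlMr ?mulr_gt0// mulrC.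
suff /eqP : ((g i : nat)%:Z - (g' i : nat)%:Z) = 0 by rewrite subr_eq0 => /eqP [].
apply: (@dist_int_ratio R _ (q i)).
  move: (ltn_ord (g i)) (ltn_ord (g' i)); move: (g i : nat) (g' i : nat) => x y; lia.
rewrite linD in arc; rewrite linD in arc'.
set w := lin M (fun j => _ + _) i in arc arc'.
rewrite intrB mulrBl -!pmulrn; move: (near i) (near' i) => /=.
set x := (g' i)%:R / _; set y := (g i)%:R / _ => near_y near_x.
rewrite (_ : y - x = (lin M (F g).2 i - lin M (F g').2 i)
  - ((lin M (F g).2 i - y) - (lin M (F g').2 i - x))); last by ring.
apply: le_lt_trans (dist_intB _ _) _.
have h1 := dist_intB (lin M (F g).2 i - y) (lin M (F g').2 i - x).
have h2 := dist_intB (c i - (lin M (F g').2 i + w)) (c i - (lin M (F g).2 i + w)).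
rewrite (_ : _ - _ = lin M (F g).2 i - lin M (F g').2 i) in h2; last by ring.
rewrite !invfM in arc arc' near_x near_y.
have : 0 < (q i)%:R^-1 :> R by rewrite invr_gt0.
lra.
Qed.

End Repetitivity.

(** * From repetitivity to block forms *)

Section Rational.
Variable R : realType.

Definition rational (x : R) :=
  exists q : nat, (0 < q)%N /\ exists z : int, q%:R * x = z%:~R.

Lemma rational_int (z : int) : rational z%:~R.
Proof. by exists 1%N; split=> //; exists z; rewrite mul1r. Qed.

Lemma rationalMz (z : int) x : rational x -> rational (z%:~R * x).
Proof.
move=> [q [q0 [w qw]]]; exists q; split=> //.
by exists (z * w); rewrite mulrCA qw intrM.
Qed.

Lemma common_denominator (I : finType) (x : I -> R) : (forall i, rational (x i)) ->
  exists q : nat, (0 < q)%N /\ forall i, exists z : int, q%:R * x i = z%:~R.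
Proof.
move=> /choice[q qP]; exists (\prod_i q i)%N; split=> [|i].
  by apply: prodn_gt0 => i; case: (qP i).
have [_ [z qz]] := qP i.
exists ((\prod_(k | k != i) q k)%N%:Z * z).
by rewrite (bigD1 i)//= mulnC natrM -mulrA qz intrM.
Qed.

Lemma rational_sum (I : finType) (x : I -> R) :
  (forall i, rational (x i)) -> rational (\sum_i x i).
Proof.
move=> /common_denominator[q [q0 /choice[z qz]]]; exists q; split=> //.
exists (\sum_i z i); rewrite mulr_sumr (raddf_sum (intmul 1)).
by apply: eq_bigr => i _; exact: qz.
Qed.

Lemma irrational_dist_gt0 x (n : nat) :
  ~ rational x -> (0 < n)%N -> 0 < dist_int (n%:R * x).
Proof.
move=> irr n0; rewrite lt_neqAle dist_int_ge0 andbT; apply/eqP => /esym.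
by move=> /dist_int_eq0[z nz]; apply: irr; exists n; split=> //; exists z.
Qed.

End Rational.

Section Blocks.
Variables (R : realType) (d e : nat) (M : 'I_d -> 'I_e -> R).
Variables (c : 'I_e -> R) (u : 'I_d -> R) (T : 'I_e -> 'I_d -> R).

Definition orbit_free := forall N : 'I_d -> int,
  (forall i, exists z : int, lin M N i = z%:~R) -> forall j, N j = 0.

Lemma lin_single (j : 'I_d) (z : int) i :
  lin M (fun k => if k == j then z else 0) i = z%:~R * M j i.
Proof.
rewrite /lin (bigD1 j)//= eqxx big1 ?addr0// => k /negbTE ->.
by rewrite mul0r.
Qed.

Hypotheses (dense : orbit_dense M) (free : orbit_free)
  (rep : box_repetitive M c u T).

(** Otherwise a common denominator [q] of the [j]-th coefficients would make all forms integral at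
    [q e_j], against freeness. *)
Let irrational_exists (j : 'I_d) : exists i, ~ rational (M j i).
Proof.
apply/existsNP => rat.
have [q [q0 qz]] := common_denominator rat.
have : (if j == j then q%:Z else 0) = 0.
  apply: (free (N := fun k => if k == j then q%:Z else 0)) => i.
  by rewrite lin_single; exact: qz.
by rewrite eqxx; case: q q0 {qz}.
Qed.

(** On a box of side [m = 4p] in direction [j] and 1 in the others, Dirichlet's theorem brings both
    forms within [1 / (4p)] of an integer, so the volume bound would read [p^2 <= 4 p B^d], which
    fails for [p > 4 B^d]. *)
Let irrational_unique (j : 'I_d) (i i' : 'I_e) :
  ~ rational (M j i) -> ~ rational (M j i') -> i = i'.
Proof.
move=> irr irr'; apply/eqP/contraT => ii'.
have [B B0 bound] := box_volume_bound dense rep.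
pose p := (4 * B ^ d).+1; pose m := (4 * p)%N.
pose q k := if (k == i) || (k == i') then p else 1%N.
have irrP k : ~ rational (M j k) -> exists N, [/\
    in_box (fun=> 0) (fun k => if k == j then m%:Z else 1) N,
    0 < dist_int (lin M N k) & 4 * p%:R * dist_int (lin M N k) <= 1].
  move=> irrk; have [|t [/andP[t0 tm] tk]] := @dirichlet R (M j k) m.
    by rewrite muln_gt0.
  exists (fun k => if k == j then t%:Z else 0); split.
  - by move=> l; case: ifP => _ //; apply/andP; split; lia.
  - by rewrite lin_single; exact: irrational_dist_gt0.
  rewrite lin_single -ler_pdivlMl; last by rewrite mulr_gt0 ?ltr0n.
  by rewrite mulr1 -natrM.
have := bound (fun=> 0) (fun k => if k == j then m%:Z else 1) _ q _.
rewrite (bigD1 i)// (bigD1 i')/=; last by rewrite eq_sym.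
have -> : q i = p by rewrite /q eqxx.
have -> : q i' = p by rewrite /q eqxx orbT.
rewrite big1 => [|k /andP[/negbTE ki /negbTE ki']]; last by rewrite /q ki ki'.
rewrite [X in (_ <= X)%N]big_split prod_nat_const card_ord /= (bigD1 j)//= eqxx.
rewrite big1 => [|k /negbTE ->] //.
rewrite subr0 absz_nat !muln1 /m => H.
suff : (p * p <= B ^ d * (4 * p))%N.
  by rewrite mulnA leq_pmul2r// mulnC ltnn.
apply: H => [k|k]; first by case: ifP.
rewrite /q; case: ifP => [/orP[/eqP ->|/eqP ->]|_]; last by left.
  by right; split=> //; exact: irrP.
by right; split=> //; exact: irrP.
Qed.

(** [b j] is the only form whose [j]-th coefficient is irrational; rational coefficients are
    dropped. A form with rational coefficients only would take finitely many values modulo 1,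
    against density, so [b] is onto. The lower bound is [box_volume_bound] with a single nontrivial
    factor [q]. *)
Theorem blocks_of_repetitive : exists (a : 'I_d -> R) (b : 'I_d -> 'I_e),
  (forall i, exists j, b j = i) /\
  forall i, exists2 c, 0 < c & linear_bad (fun j => b j == i) a c.
Proof.
have /choice[b bP] := irrational_exists.
have ratP j i : b j != i -> rational (M j i).
  by move=> bji; apply: contrapT => irr; rewrite (irrational_unique (bP j) irr) eqxx in bji.
exists (fun j => M j (b j)), b; split=> i.
  apply: contrapT => /forallNP nb.
  have [q [q0 /choice[z qz]]] : exists q : nat, (0 < q)%N /\
      forall j, exists z : int, q%:R * M j i = z%:~R.
    by apply: common_denominator => j; apply: ratP; apply/eqP => /nb.
  have qR : 0 < q%:R :> R by rewrite ltr0n.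
  (* At the target [1 / (2q)], multiplication by [q] makes the form integral and leaves distance
     1/2, while the precision allows less than 1/4. *)
  have [|n /(_ i)] := dense (fun=> 2^-1 / q%:R) (eps := fun=> 4^-1 / q%:R).
    by move=> _; rewrite divr_gt0.
  rewrite ltr_pdivlMr// mulrC => near.
  have {near} := le_lt_trans (dist_intMn _ _) near.
  rewrite mulrBr mulrCA divff ?mulr1 ?gt_eqF//.
  have -> : q%:R * lin M n i = (\sum_j n j * z j)%:~R.
    rewrite /lin mulr_sumr (raddf_sum (intmul 1)); apply: eq_bigr => j _.
    by rewrite /= mulrCA qz intrM.
  rewrite addrC dist_intDz dist_int_small normrN ger0_norm ?invr_ge0//; lra.
have [B B0 bound] := box_volume_bound dense rep.
have B1 : 1 <= (B ^ d)%:R :> R by rewrite ler1n expn_gt0 B0.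
exists (8 * (B ^ d)%:R)^-1 => [|N [j bj Nj]].
  by rewrite invr_gt0; lra.
pose N' j := if b j == i then N j else 0.
have linN' : lin M N' i = \sum_(j | b j == i) (N j)%:~R * M j (b j).
  rewrite /lin [RHS]big_mkcond; apply: eq_bigr => k _; rewrite /N'.
  by case: ifP => [/eqP ->|]; rewrite ?mul0r.
rewrite -linN' natr_prod.
set P := \prod_(k | _) _; have P1 : 1 <= P.
  rewrite /P -natr_prod ler1n prodn_gt0// => k; by rewrite leq_max.
(* If the [i]-th form were integral at [N'], all other forms would be rational there, as their
   coefficients on this block are, and a multiple of [N'] would contradict freeness. *)
have d0 : 0 < dist_int (lin M N' i).
  rewrite lt_neqAle dist_int_ge0 andbT; apply/eqP => /esym/dist_int_eq0[w lw].
  have rat k : rational (lin M N' k).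
    have [->|ik] := eqVneq k i; first by rewrite lw; exact: rational_int.
    apply: rational_sum => l; rewrite /N'; case: ifP => [/eqP bl|_].
      by apply: rationalMz; apply: ratP; rewrite bl eq_sym.
    by rewrite mul0r; exact: rational_int 0.
  have [q [q0 qz]] := common_denominator rat.
  have : q%:Z * N' j = 0.
    apply: (free (N := fun j => q%:Z * N' j)) => k.
    have [z qz'] := qz k; exists z; rewrite -qz' /lin mulr_sumr.
    by apply: eq_bigr => l _; rewrite intrM mulrA.
  by move/eqP; rewrite /N' bj mulf_eq0 (negbTE Nj) orbF; case: q q0 {qz}.
(* Above 1/4 the truncation [q] below would be 0; there the bound follows from [P >= 1]. *)
have [dist4|dist4] := ltP 4^-1 (dist_int (lin M N' i)).
  apply: (@le_trans _ _ (4^-1 * 1)); last by apply: ler_pM; lra.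
  by rewrite mulr1 lef_pV2 ?posrE; lra.
pose x := (4 * dist_int (lin M N' i))^-1; pose q := Num.truncn x.
have x1 : 1 <= x by rewrite /x invf_ge1; lra.
have qx : q%:R <= x by rewrite truncn_le; lra.
have q1 : (0 < q)%N by rewrite truncn_gt0.
have xq : x < q%:R + 1 by rewrite natr1 truncnS_gt.
(* The box spanned by 0 and [N'], thickened to side 1 where [N'] vanishes; its sides are
   [max (1, |N' k|)]. *)
pose lo k : int := Order.min (N' k) 0.
pose hi k : int := if N' k == 0 then 1 else Order.max (N' k) 0.
have := bound lo hi _ (fun k => if k == i then q else 1%N) _.
rewrite (bigD1 i)//= eqxx big1 ?muln1 => [|k /negbTE -> //].
rewrite big_split prod_nat_const card_ord /= => H.
have {H} : (q <= B ^ d * \prod_(k | b k == i) maxn 1 `|N k|)%N.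
  rewrite [X in (_ * X)%N]big_mkcond; apply: leq_trans (H _ _) _; last first.
  - rewrite leq_pmul2l ?expn_gt0 ?B0//; apply: leq_prod => k _.
    rewrite /hi /lo /N'; case: (b k == i); rewrite ?eqxx ?minxx //=.
    by case: eqVneq => [->|] //; lia.
  - move=> k; case: ifP => [/eqP ->|_]; last by left.
    right; split=> //; exists N'; split=> //; last first.
      rewrite mulrAC -ler_pdivlMl; last by lra.
      by rewrite mulr1.
    by move=> l; rewrite /lo /hi; case: eqP => [->|] //; lia.
  - by move=> k; rewrite /lo /hi; case: eqP => [->|] //; split; lia.
rewrite -(ler_nat R) natrM natr_prod -/P => qB.
have : x <= 2 * ((B ^ d)%:R * P).
  have : 1 <= q%:R :> R by rewrite ler1n.
  lra.
rewrite /x -[leLHS]mul1r ler_pdivrMr ?mulr_gt0// => key.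
rewrite -[leLHS]mul1r ler_pdivrMr; last by lra.
lra.
Qed.

End Blocks.

(** * From block forms to repetitivity *)

Lemma exists_argmax (R : realType) (X : finType) (x0 : X) (f : X -> R) :
  exists x, forall y, f y <= f x.
Proof.
have [x _ xP] := arg_maxP f (isT : xpredT x0); exists x => y; exact: xP.
Qed.

Section BlockForms.
Variables (R : realType) (d e : nat) (a : 'I_d -> R) (b : 'I_d -> 'I_e).

Definition block_coef (j : 'I_d) (i : 'I_e) : R := if b j == i then a j else 0.

Lemma lin_blockE N i :
  lin block_coef N i = \sum_(j | b j == i) (N j)%:~R * a j.
Proof.
rewrite /lin [RHS]big_mkcond; apply: eq_bigr => j _.
by rewrite /block_coef; case: ifP => //; rewrite mulr0.
Qed.

Hypothesis surj : forall i, exists j, b j = i.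
Hypothesis bad : forall i, exists2 c, 0 < c & linear_bad (fun j => b j == i) a c.

Lemma block_free N i (z : int) : lin block_coef N i = z%:~R ->
  forall j, b j = i -> N j = 0.
Proof.
move=> lz j bj; apply/eqP; apply: contraT => Nj.
have [c c0 badc] := bad i.
have := badc N (ex_intro2 _ _ j (introT eqP bj) Nj).
have -> : dist_int (\sum_(j | b j == i) (N j)%:~R * a j) = 0.
  apply/eqP; rewrite eq_le dist_int_ge0 andbT -lin_blockE lz.
  by apply: le_trans (dist_int_le _ z) _; rewrite subrr normr0.
by rewrite mul0r leNgt c0.
Qed.

Lemma block_free_all : orbit_free block_coef.
Proof. by move=> N Nz j; have [z lz] := Nz (b j); exact: block_free lz _ _. Qed.

(** Each form involves its own block only, so the coordinates are approximated separately and the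
    solutions glued along [b]. *)
Lemma block_dense : orbit_dense block_coef.
Proof.
move=> g eps eps0.
have /choice[N NP] : forall i, exists N : 'I_d -> int,
    dist_int (\sum_(j | b j == i) (N j)%:~R * a j - g i) < eps i.
  move=> i; have [c c0 badc] := bad i.
  have [r r0 inhom] := inhom_linear c0 badc.
  pose H := Num.truncn (r%:R * c / eps i).
  have [N [_ _ near]] := inhom (fun=> H) (g i); exists N.
  apply: le_lt_trans near _; rewrite mulrA.
  have [j bj] := surj i.
  have HP : H.+1%:R <= (\prod_(j | b j == i) H.+1)%:R :> R.
    rewrite ler_nat (bigD1 j) ?bj//= leq_pmulr//.
    exact: prodn_gt0.
  have H0 : 0 < H.+1%:R :> R by rewrite ltr0n.
  rewrite ltr_pdivrMr; last exact: lt_le_trans HP.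
  rewrite -ltr_pdivrMl// mulrC; apply: lt_le_trans HP; exact: truncnS_gt.
exists (fun j => N (b j) j) => i; rewrite lin_blockE.
by under eq_bigr => j /eqP -> do []; exact: NP.
Qed.

Variables (c : 'I_e -> R) (u : 'I_d -> R) (T : 'I_e -> 'I_d -> R).

Local Notation phase := (phase block_coef c).

(* The phases with the same pattern as [n0] in coordinate [i] form an interval
   [x0 - min phi, x0 + 1 - max phi), where [phi N] is the fractional part of
   [x0 - lin N]; its length is [lin] of a difference of two points of the box
   modulo 1, hence bounded below. *)
Lemma same_pattern_interval (lo hi n0 : 'I_d -> int) (i : 'I_e) (c1 : R) :
  (forall j, lo j <= 0 <= hi j /\ lo j < hi j) ->
  0 < c1 <= 1 -> linear_bad (fun j => b j == i) a c1 ->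
  exists v w : R, [/\ 0 <= v, w <= 1,
    c1 <= (w - v) * (\prod_(j | b j == i) `|(hi j - lo j)%R|)%:R &
    forall y, v < y < w -> forall N, in_box lo hi N ->
      Num.floor (y - lin block_coef N i) =
      Num.floor (phase n0 i - lin block_coef N i)].
Proof.
move=> lohi /andP[c10 c11] badc; set x0 := phase n0 i.
pose X := {dffun forall j, 'I_(`|(hi j - lo j)%R|.+1)}.
pose pt (f : X) j : int := lo j + (f j : nat)%:Z.
have pt_onto N : in_box lo hi N -> exists f, pt f = N.
  move=> Nbox; have lt j : (`|(N j - lo j)%R| < `|(hi j - lo j)%R|.+1)%N.
    by have := Nbox j; lia.
  exists (finfun (fun j => Ordinal (lt j))); apply/funext => j.
  by rewrite /pt ffunE /=; have := Nbox j; lia.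
have [f0 f0E] : exists f, pt f = fun=> 0.
  by apply: pt_onto => j; case: (lohi j).
pose phi f := frac (x0 - lin block_coef (pt f) i).
have phi0 : phi f0 = x0.
  by rewrite /phi f0E lin0 subr0 (@frac_unique _ x0 0) subr0 ?frac_itv.
have [fx fxP] := exists_argmax f0 phi.
have [fn fnP'] := exists_argmax f0 (fun f => - phi f).
have fnP f : phi fn <= phi f by have := fnP' f; rewrite lerN2.
have /andP[x00 x01] : 0 <= x0 < 1 by exact: frac_itv.
exists (x0 - phi fn), (x0 + 1 - phi fx); split.
- by have := fnP f0; rewrite phi0; lra.
- by have := fxP f0; rewrite phi0; lra.
- have -> : x0 + 1 - phi fx - (x0 - phi fn) = 1 - phi fx + phi fn by ring.
  set W := \prod_(j | _) _; have W1 : 1 <= W%:R :> R.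
    by rewrite ler1n prodn_gt0// => j; case: (lohi j); lia.
  have /andP[fx0 fx1] := frac_itv (x0 - lin block_coef (pt fx) i).
  have /andP[fn0 fn1] := frac_itv (x0 - lin block_coef (pt fn) i).
  rewrite -/(phi fx) in fx0 fx1; rewrite -/(phi fn) in fn0 fn1.
  (* Extremal points that agree on the block have the same phase, and the length is then 1;
     otherwise the length is congruent modulo 1 to the form at their difference, which is nonzero on
     the block. *)
  have [same|/existsNP[j /not_implyP[bj Nj]]] :=
      pselect (forall j, b j == i -> pt fx j = pt fn j).
    rewrite (_ : phi fx = phi fn); last first.
      rewrite /phi !lin_blockE; congr (frac (_ - _)).
      by apply: eq_bigr => j bj; rewrite same.
    by rewrite subrK mul1r; lra.
  have := badc (fun j => pt fx j - pt fn j) _; rewrite -lin_blockE linB.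
  move=> /(_ _)/le_trans; apply.
    by exists j => //; rewrite subr_eq0; apply/eqP.
  apply: ler_pM => //; first exact: dist_int_ge0.
    pose z := - 1 - Num.floor (x0 - lin block_coef (pt fx) i)
      + Num.floor (x0 - lin block_coef (pt fn) i).
    apply: le_trans (dist_int_le _ z) _.
    rewrite (_ : _ - _ = 1 - phi fx + phi fn).
      by rewrite ger0_norm//; lra.
    by rewrite /z /phi /frac !intrD !intrN; ring.
  rewrite ler_nat; apply: leq_prod => k _; rewrite geq_max.
  have [_ lt_k] := lohi k; rewrite absz_gt0 subr_eq0 gt_eqF//=.
  move: (ltn_ord (fx k)) (ltn_ord (fn k)); rewrite /pt.
  by move: (fx k : nat) (fn k : nat) => p q; lia.
- move=> y /andP[y0 y1] N /pt_onto[f <-].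
  have := fnP f; have := fxP f.
  have -> : phi f = x0 - lin block_coef (pt f) i -
    (Num.floor (x0 - lin block_coef (pt f) i))%:~R by [].
  by move=> le_fx le_fn; apply: floor_def; rewrite intrD; apply/andP; split; lra.
Qed.

(** Starting from [base], near the centre of the dilated box, [inhom_linear] gives in each block a
    displacement that moves the phase into the interval with the pattern of [n0]. It is bounded by a
    constant times the sides, which [C] absorbs. *)
Theorem repetitive_of_blocks : box_repetitive block_coef c u T.
Proof.
have /choice[cr crP] : forall i, exists p : R * nat, [/\ 0 < p.1 <= 1,
    linear_bad (fun j => b j == i) a p.1, (0 < p.2)%N &
    forall (B : 'I_d -> nat) (g : R), exists N : 'I_d -> int,
    (forall j, b j == i -> (`|N j| <= p.2 * B j)%N) /\
    dist_int (\sum_(j | b j == i) (N j)%:~R * a j - g) <=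
      p.2%:R * (p.1 / (\prod_(j | b j == i) (B j).+1)%:R)].
  move=> i; have [c1 c10 badc] := bad i; pose c2 := Num.min c1 1.
  have c20 : 0 < c2 by rewrite lt_min c10 ltr01.
  have badc2 : linear_bad (fun j => b j == i) a c2.
    by move=> N Nj; apply: le_trans (badc N Nj); rewrite ge_min lexx.
  have [r r0 inhom] := inhom_linear c20 badc2.
  exists (c2, r); split=> //=; first by rewrite c20 ge_min lexx orbT.
  by move=> B g; have [N [N1 _ N2]] := inhom B g; exists N.
pose tau : R := \sum_i \sum_j `|T i j|.
have tau0 : 0 <= tau by apply: sumr_ge0 => i _; apply: sumr_ge0.
(* In [C], [rho] accounts for the displacement relative to the sides, [tau] for the phase term and 1
   for the floor in [base]. *)
pose rho : R := \sum_i (4 * (cr i).2 ^ 2)%:R.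
have rho0 : 0 <= rho by apply: sumr_ge0.
pose C := 2 * (1 + tau + rho).
exists C => [|lo hi lohi n0 t]; first by rewrite /C; lra.
pose base j := Num.floor (t j - u j + C * ((lo j)%:~R + (hi j)%:~R) / 2).
have /choice[N NP] : forall i, exists N : 'I_d -> int,
    (forall j, b j == i -> (`|N j| <= 4 * (cr i).2 ^ 2 * `|(hi j - lo j)%R|)%N) /\
    forall n, (forall j, b j == i -> n j = base j + N j) ->
    forall N, in_box lo hi N -> Num.floor (phase n i - lin block_coef N i) =
      Num.floor (phase n0 i - lin block_coef N i).
  move=> i; have [c1 badc r0 inhom] := crP i.
  set r := (cr i).2 in r0 inhom *.
  have [v [w [v0 w1 len pat]]] := same_pattern_interval n0 lohi c1 badc.
  (* The target moves the phase at [base] to the midpoint of the interval; the factor [4 r] enlarges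
     the box until the error is below the half-length [(w - v) / 2]. *)
  have [N [Nb near]] := inhom (fun j => 4 * r * `|(hi j - lo j)%R|)%N
    (c i - lin block_coef base i - (v + w) / 2).
  exists N; split=> [j bj|n nE].
    by apply: leq_trans (Nb j bj) _; rewrite -mulnn !mulnA (mulnC r).
  apply: pat.
  have half : dist_int (\sum_(j | b j == i) (N j)%:~R * a j -
      (c i - lin block_coef base i - (v + w) / 2)) < (w - v) / 2.
    apply: le_lt_trans near _.
    set W := (\prod_(j | b j == i) `|(hi j - lo j)%R|)%N in len.
    have W1 : 1 <= W%:R :> R.
      by rewrite ler1n prodn_gt0// => j; case: (lohi j); lia.
    set P := (\prod_(j | b j == i) _)%N.
    have rR : 1 <= r%:R :> R by rewrite ler1n.
    have WP : 4 * r%:R * W%:R <= P%:R :> R.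
      rewrite -!natrM ler_nat /W /P; have [j bj] := surj i.
      rewrite (bigD1 j) ?bj//= [leqRHS](bigD1 j) ?bj//= mulnA.
      apply: leq_mul; first exact: leqnSn.
      by apply: leq_prod => k _; apply: leqW; apply: leq_pmull; rewrite muln_gt0.
    have P0 : 0 < P%:R :> R by apply: lt_le_trans WP; nra.
    rewrite mulrA ltr_pdivrMr//.
    have /andP[c10 _] := c1.
    have wv0 : 0 < w - v by rewrite -(pmulr_lgt0 _ (lt_le_trans ltr01 W1)); lra.
    apply: (@lt_le_trans _ _ ((w - v) / 2 * (4 * r%:R * W%:R))).
      rewrite (_ : _ * (4 * _ * _) = 2 * r%:R * ((w - v) * W%:R)); last by field.
      apply: (@lt_le_trans _ _ (2 * r%:R * (cr i).1)); first nra.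
      by rewrite ler_pM2l//; lra.
    by rewrite ler_pM2l//; lra.
  have nlin : lin block_coef n i = lin block_coef base i +
      \sum_(j | b j == i) (N j)%:~R * a j.
    rewrite !lin_blockE -big_split /=; apply: eq_bigr => j bj.
    by rewrite nE// intrD mulrDl.
  have {}half : dist_int (c i - lin block_coef n i - (v + w) / 2) < (w - v) / 2.
    rewrite -dist_intN nlin.
    rewrite (_ : - _ = \sum_(j | b j == i) (N j)%:~R * a j -
      (c i - lin block_coef base i - (v + w) / 2))//; ring.
  have := frac_near half; rewrite -/(phase n i).
  rewrite (_ : _ - (w - v) / 2 = v); last by field.
  rewrite (_ : _ + (w - v) / 2 = w); last by field.
  by apply.
exists (fun j => base j + N (b j) j); split=> [j|N' N'box i]; last first.
  by apply: (proj2 (NP i)) => // j /eqP ->.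
have := phase_shift_le block_coef c T (fun j => base j + N (b j) j) j.
rewrite -/tau; set s := \sum_i _; rewrite ler_norml => /andP[s1 s2].
have := proj1 (NP (b j)) j (eqxx _); rewrite -(ler_nat R) natr_absz intr_norm natrM.
have [_ lt_j] := lohi j.
rewrite natr_absz intr_norm intrB [X in _ * X]ger0_norm; last first.
  by rewrite subr_ge0 ler_int ltW.
have D1 : 1 <= (hi j)%:~R - (lo j)%:~R :> R.
  by rewrite -intrB -[1]/(1%:~R) ler_int; lia.
have rb : (4 * (cr (b j)).2 ^ 2)%:R <= rho.
  by rewrite /rho (bigD1 (b j))//= lerDl sumr_ge0.
move=> Nle; have {Nle rb} : `|(N (b j) j)%:~R| <= rho * ((hi j)%:~R - (lo j)%:~R).
  by apply: le_trans Nle _; rewrite ler_pM2r//; lra.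
rewrite ler_norml => /andP[N1 N2].
have /andP[f1 f2] := floor_itv (t j - u j + C * ((lo j)%:~R + (hi j)%:~R) / 2).
rewrite -/(base j) intrD in f1 f2; rewrite intrD.
have CE : C * ((hi j)%:~R - (lo j)%:~R) / 2 = (1 + tau) * ((hi j)%:~R - (lo j)%:~R)
    + rho * ((hi j)%:~R - (lo j)%:~R) by rewrite /C; field.
have : 1 + tau <= (1 + tau) * ((hi j)%:~R - (lo j)%:~R) by rewrite ler_peMr//; lra.
move: CE f1 f2 N1 N2 D1; move: ((hi j)%:~R) ((lo j)%:~R) => H L CE f1 f2 N1 N2 D1 ?.
by apply/andP; split; lra.
Qed.

End BlockForms.

(** * Geometry of cut and project sets *)

Section LinearAlgebra.
Variables (R : realType) (d e : nat).
Local Notation k := (d + e)%N.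

Lemma linear_mx (m n : nat) (f : 'rV[R]_m -> 'rV[R]_n) :
  linear f -> exists A : 'M[R]_(m, n), forall u, f u = u *m A.
Proof.
move=> lin; pose g : {linear _ -> _} := HB.pack f (GRing.isLinear.Build _ _ _ _ f lin).
by exists (lin1_mx g) => u; rewrite mul_rV_lin1.
Qed.

Lemma mem_Frho (v : 'rV[R]_k) : (v \in Frho R k d) = (lsubmx v == 0).
Proof.
apply/idP/eqP.
  move=> /memv_sumP[w wP ->]; apply/matrixP => i j; rewrite !mxE summxE big1// => l dl.
  have /vlineP[a ->] := wP l dl; rewrite !mxE (_ : _ == l = false) ?andbF ?mulr0//.
  by apply/negbTE; apply: contraTneq dl => <-; rewrite -ltnNge /= ltn_ord.
move=> v0; rewrite (row_sum_delta v) (bigID (fun j : 'I_k => (d <= j)%N)) /= addrC big1.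
  by rewrite add0r; apply: memv_sumr => j dj; rewrite memvZ// memv_line.
move=> j; rewrite -ltnNge => jd; suff -> : v 0 j = 0 by rewrite scale0r.
have := congr1 (fun x : 'rV_d => x 0 (Ordinal jd)) v0; rewrite !mxE => <-.
by congr (v _ _); exact/val_inj.
Qed.

Lemma complementary_pi (U V : {vspace 'rV[R]_k}) v : complementary U V ->
  daddv_pi U V v \in U /\ v - daddv_pi U V v \in V.
Proof.
move=> [UV I0]; split; first exact: memv_pi.
have /(daddv_pi_add I0) E : v \in (U + V)%VS by rewrite UV memvf.
by rewrite -{1}E [X in X - _]addrC addrK memv_pi.
Qed.

(** The vectors [(y T, y)]: the form in which F_pi is constructed; [T = 0] gives F_rho. *)
Definition cograph (T : 'M[R]_(e, d)) : {vspace 'rV[R]_k} :=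
  limg (linfun (mulmxr (row_mx T 1%:M) : 'rV[R]_e -> 'rV[R]_k)).

Definition graph (A : 'M[R]_(d, e)) : {vspace 'rV[R]_k} :=
  limg (linfun (mulmxr (row_mx 1%:M A) : 'rV[R]_d -> 'rV[R]_k)).

Lemma mem_cograph T v : (v \in cograph T) = (lsubmx v == rsubmx v *m T).
Proof.
apply/idP/eqP => [/memv_imgP[x _ ->]|vT].
  by rewrite lfunE /= mul_mx_row row_mxKl row_mxKr mulmx1.
apply/memv_imgP; exists (rsubmx v); first exact: memvf.
by rewrite lfunE /= mul_mx_row mulmx1 -vT hsubmxK.
Qed.

Lemma mem_graph A v : (v \in graph A) = (rsubmx v == lsubmx v *m A).
Proof.
apply/idP/eqP => [/memv_imgP[x _ ->]|vA].
  by rewrite lfunE /= mul_mx_row row_mxKl row_mxKr mulmx1.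
apply/memv_imgP; exists (lsubmx v); first exact: memvf.
by rewrite lfunE /= mul_mx_row mulmx1 -vA hsubmxK.
Qed.

Lemma dim_graph A : \dim (graph A) = d.
Proof.
rewrite limg_dim_eq ?dimvf ?/dim /= ?mul1n//.
apply/eqP; rewrite capfv; apply/lker0P => x y; rewrite !lfunE /= !mul_mx_row !mulmx1.
by move=> /eq_row_mx[].
Qed.

Lemma dim_cograph T : \dim (cograph T) = e.
Proof.
rewrite limg_dim_eq ?dimvf ?/dim /= ?mul1n//.
apply/eqP; rewrite capfv; apply/lker0P => x y; rewrite !lfunE /= !mul_mx_row !mulmx1.
by move=> /eq_row_mx[].
Qed.

(** A common vector is [(y T, y)] with [y = y T A], hence 0, and the dimensions [d] and [e] then
    fill the space. *)
Lemma complementary_graph A T : (forall x : 'rV_e, x *m T *m A = x -> x = 0) ->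
  complementary (graph A) (cograph T).
Proof.
move=> TA.
have I0 : (graph A :&: cograph T)%VS = 0%VS.
  apply/eqP; rewrite -subv0; apply/subvP => v; rewrite memv_cap mem_graph mem_cograph.
  move=> /andP[/eqP rA /eqP lT]; rewrite memv0 -[v]hsubmxK.
  have r0 : rsubmx v = 0 by apply: TA; rewrite -lT.
  by rewrite lT r0 mul0mx row_mx0.
split=> //; apply/eqP; rewrite eqEdim subvf /= dimvf /dim /= mul1n.
by rewrite dimv_disjoint_sum// dim_graph dim_cograph.
Qed.

Lemma Frho_cograph : Frho R k d = cograph 0.
Proof. by apply/vspaceP => v; rewrite mem_Frho mem_cograph mulmx0. Qed.

End LinearAlgebra.

Section Graph.
Variables (R : realType) (d e : nat) (S : cut_project R (d + e) d).
Local Notation k := (d + e)%N.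

(** Adding F_rho does not change the first [d] coordinates, so [rho] lifts each [u] of R^d to the
    point of [E] over it, unique because [E] meets F_rho in 0. *)
Lemma cps_E_graph : exists A : 'M[R]_(d, e), cps_E S = graph A.
Proof.
have [|A AP] := @linear_mx R d e (fun u => rsubmx (cps_rho S (row_mx u 0))).
  move=> t u v /=.
  have -> : row_mx (t *: u + v) 0 = t *: row_mx u 0 + row_mx v 0 :> 'rV[R]_k.
    by rewrite scale_row_mx add_row_mx scaler0 addr0.
  by rewrite /cps_rho linearP; apply/rowP => j; rewrite !mxE.
have rhoP v := complementary_pi v (cps_compl_rho S).
exists A; apply/vspaceP => v; rewrite mem_graph.
set w := cps_rho S (row_mx (lsubmx v) 0).
have [wE wF] : w \in cps_E S /\ row_mx (lsubmx v) 0 - w \in Frho R k d.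
  exact: rhoP.
have wl : lsubmx w = lsubmx v.
  by move: wF; rewrite mem_Frho linearB /= row_mxKl subr_eq0 => /eqP.
have wr : rsubmx w = lsubmx v *m A by rewrite -AP.
apply/idP/eqP => [vE|vr].
  have [_ I0] := cps_compl_rho S.
  have : v - w \in (cps_E S :&: Frho R k d)%VS.
    by rewrite memv_cap memvB// mem_Frho linearB /= wl subrr.
  by rewrite I0 memv0 subr_eq0 => /eqP ->; rewrite wr wl.
suff -> : v = w by [].
by rewrite -[v]hsubmxK -[w]hsubmxK wl wr vr.
Qed.

Variable A : 'M[R]_(d, e).
Hypothesis EA : cps_E S = graph A.

(* The component along [Frho] of [v] in the decomposition E + F_rho. *)
Definition offset (v : 'rV[R]_k) : 'rV[R]_e := rsubmx v - lsubmx v *m A.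

Definition on_graph (u : 'rV[R]_d) : 'rV[R]_k := row_mx u (u *m A).

Lemma on_graph_inj : injective on_graph.
Proof. by move=> u v /eq_row_mx[]. Qed.

Lemma offsetD v w : offset (v + w) = offset v + offset w.
Proof. by apply/rowP => i; rewrite /offset !linearD mulmxDl !mxE; ring. Qed.

Lemma offset_graph v : (v \in cps_E S) = (offset v == 0).
Proof. by rewrite EA mem_graph subr_eq0. Qed.

Lemma graphE v : v \in cps_E S -> v = on_graph (lsubmx v).
Proof. by rewrite EA mem_graph => /eqP vA; rewrite /on_graph -vA hsubmxK. Qed.

Lemma decomposition v : v = on_graph (lsubmx v) + row_mx 0 (offset v).
Proof. by rewrite /on_graph add_row_mx addr0 addrC subrK hsubmxK. Qed.

Lemma on_graphE u : on_graph u \in cps_E S.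
Proof. by rewrite EA mem_graph row_mxKl row_mxKr. Qed.

Lemma cps_rhoE v : cps_rho S v = on_graph (lsubmx v).
Proof.
have [vE vF] := complementary_pi v (cps_compl_rho S).
rewrite -/(cps_rho S v) in vE vF; rewrite (graphE vE).
by move: vF; rewrite mem_Frho linearB /= subr_eq0 => /eqP ->.
Qed.

Lemma cps_pi_id v : v \in cps_E S -> cps_pi S v = v.
Proof. by move=> vE; rewrite /cps_pi daddv_pi_id//; case: (cps_compl_pi S). Qed.

Lemma cps_piD v w : cps_pi S (v + w) = cps_pi S v + cps_pi S w.
Proof. exact: linearD. Qed.

Lemma cps_piB v w : cps_pi S (v - w) = cps_pi S v - cps_pi S w.
Proof. exact: linearB. Qed.

(** [pi] fixes [E], so by [decomposition] it is determined by its values on F_rho, which [T]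
    records. *)
Lemma cps_piE : exists T : 'M[R]_(e, d),
  forall v, cps_pi S v = on_graph (lsubmx v + offset v *m T).
Proof.
have [|T TP] := @linear_mx R e d (fun w => lsubmx (cps_pi S (row_mx 0 w))).
  move=> t u v /=.
  have -> : row_mx 0 (t *: u + v) = t *: row_mx 0 u + row_mx 0 v :> 'rV[R]_k.
    by rewrite scale_row_mx add_row_mx scaler0 addr0.
  by rewrite /cps_pi linearP; apply/rowP => j; rewrite !mxE.
exists T => v; rewrite {1}(decomposition v) cps_piD cps_pi_id ?on_graphE//.
have pE : cps_pi S (row_mx 0 (offset v)) \in cps_E S.
  by have [] := complementary_pi (row_mx 0 (offset v)) (cps_compl_pi S).
rewrite (graphE pE) TP; apply/rowP => j.
by rewrite /on_graph add_row_mx -mulmxDl.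
Qed.

Lemma rho_imgE (Om : set 'rV[R]_d) u : rho_img S Om (on_graph u) <-> Om u.
Proof.
have emb v : cps_rho S (embed k v) = on_graph v.
  by rewrite cps_rhoE /embed pid_mx_row mul_mx_row mulmx1 mulmx0 row_mxKl.
split=> [[_ [v Ov <-]]|Ou]; first by rewrite emb => /on_graph_inj <-.
by exists (embed k u); [exists u|exact: emb].
Qed.

Lemma cubeP (x : 'rV[R]_k) :
  [set \sum_(j < k | (d <= j)%N) t j *: basis_vec R j | t in
     [set t : 'I_k -> R | forall j : 'I_k, (d <= j)%N -> 0 <= t j < 1]] x <->
  lsubmx x = 0 /\ forall i, 0 <= x 0 (rshift d i) < 1.
Proof.
have entry (t : 'I_k -> R) l : (\sum_(j < k | (d <= j)%N) t j *: basis_vec R j) 0 l =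
    if (d <= l)%N then t l else 0.
  rewrite summxE; case: ifP => dl.
    rewrite (bigD1 l)//= !mxE !eqxx mulr1 big1 ?addr0// => j /andP[_ jl].
    by rewrite !mxE eq_sym (negbTE jl) andbF mulr0.
  rewrite big1// => j dj; rewrite !mxE (_ : l == j = false) ?andbF ?mulr0//.
  by apply/negbTE; apply: contraFneq dl => ->.
split=> [[t t01 <-]|[x0 x01]].
  split=> [|i]; first by apply/rowP => j; rewrite !mxE entry /= leqNgt ltn_ord.
  by rewrite entry /= leq_addr; apply: t01; rewrite /= leq_addr.
exists (fun j => x 0 j).
  by move=> j dj /=; have := splitP j; case=> l jl; first (by rewrite jl leqNgt ltn_ord in dj);
    have -> : j = rshift d l by [exact: val_inj|].
apply/rowP => l; rewrite entry; case: ifP => // dl.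
have lt : (l < d)%N by rewrite ltnNge dl.
have := congr1 (fun y : 'rV_d => y 0 (Ordinal lt)) x0; rewrite !mxE => <-.
by congr (x _ _); exact/val_inj.
Qed.

Hypothesis cubical : cubical_window S.

(** The strip is invariant under [E], so [v] may be moved along [E] into F_rho, where the strip is
    the unit cube. *)
Lemma stripE v : strip S v <-> forall i, 0 <= offset v 0 i < 1.
Proof.
have mono v' w : w \in cps_E S -> strip S v' -> strip S (v' + w).
  move=> wE [x Wx [y yE <-]]; exists x => //; exists (y + w); last by rewrite addrA.
  by rewrite /= memvD.
have -> : strip S v <-> strip S (row_mx 0 (offset v)).
  rewrite {1}(decomposition v); split=> H; last first.
    by rewrite addrC; apply: mono => //; exact: on_graphE.
  rewrite -(addKr (on_graph (lsubmx v)) (row_mx _ _)) addrC.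
  by apply: mono => //; rewrite memvN on_graphE.
transitivity (window S (row_mx 0 (offset v))).
  by split=> [H|[]//]; split=> //=; rewrite mem_Frho row_mxKl.
rewrite cubical cubeP row_mxKl; split=> [[_ H] i|H]; first by have := H i; rewrite row_mxEr.
by split=> // i; rewrite row_mxEr.
Qed.

End Graph.

Section IntRow.
Variables (R : realType) (m : nat).

Definition int_row (n : 'I_m -> int) : 'rV[R]_m := \row_j (n j)%:~R.

Lemma int_row_inj : injective int_row.
Proof.
by move=> n n' /rowP E; apply/funext => j; have := E j; rewrite !mxE => /intr_inj.
Qed.

Lemma int_rowB n n' : int_row (fun j => n j - n' j) = int_row n - int_row n'.
Proof. by apply/rowP => j; rewrite !mxE intrB. Qed.

Lemma int_latticeP (x : 'rV[R]_m) : int_lattice x <-> exists n, x = int_row n.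
Proof.
split=> [/mxOverP xint|[n ->]].
  have /choice[n nP] : forall j, exists z : int, x 0 j = z%:~R.
    by move=> j; exact/intrP.
  by exists n; apply/rowP => j; rewrite mxE.
by apply/mxOverP => i j; rewrite mxE; apply/intrP; exists (n j).
Qed.

End IntRow.
Arguments int_row {R m}.

Lemma lin_mulmx (R : realType) (d e : nat) (A : 'M[R]_(d, e)) (n : 'I_d -> int) i :
  (int_row n *m A) 0 i = lin (fun j i => A j i) n i.
Proof. by rewrite mxE; apply: eq_bigr => j _; rewrite mxE. Qed.

(** * Parametrization of the points and patches by Z^d *)

Section Points.
Variables (R : realType) (d e : nat) (S : cut_project R (d + e) d).
Variable A : 'M[R]_(d, e).
Hypotheses (EA : cps_E S = graph A) (cubical : cubical_window S).
Variable T : 'M[R]_(e, d).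
Hypothesis piT : forall v, cps_pi S v = on_graph A (lsubmx v + offset A v *m T).

Local Notation k := (d + e)%N.
Local Notation M := (fun j i => A j i).

Definition shift_phase (i : 'I_e) : R := offset A (cps_shift S) 0 i.
Local Notation c := shift_phase.

Definition lattice_point (n : 'I_d -> int) (m : 'I_e -> int) : 'rV[R]_k :=
  row_mx (int_row n) (int_row m).

(* The lattice points over [n] form a coset of Z^e, and the cubical window is a
   fundamental domain, so exactly one of them lies in the strip. *)
Definition height (n : 'I_d -> int) (i : 'I_e) : int := - Num.floor (c i - lin M n i).

Definition cps_point (n : 'I_d -> int) : 'rV[R]_k :=
  cps_pi S (lattice_point n (height n) + cps_shift S).

Lemma lattice_pointP z : int_lattice z <-> exists n m, z = lattice_point n m.
Proof.
split=> [/int_latticeP[f ->]|[n [m ->]]].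
  exists (fun j => f (lshift e j)), (fun i => f (rshift d i)).
  by rewrite -[LHS]hsubmxK; congr row_mx; apply/rowP => j; rewrite !mxE.
apply/mxOverP => i j; rewrite mxE; case: (fintype.split j) => l; rewrite mxE; apply/intrP; eexists; reflexivity.
Qed.

Lemma lattice_pointB n m n' m' : lattice_point (fun j => n j - n' j) (fun i => m i - m' i) =
  lattice_point n m - lattice_point n' m'.
Proof. by rewrite /lattice_point !int_rowB opp_row_mx add_row_mx. Qed.

Lemma lattice_point_inj n m n' m' :
  lattice_point n m = lattice_point n' m' -> n = n' /\ m = m'.
Proof. by move=> /eq_row_mx[/int_row_inj -> /int_row_inj ->]. Qed.

Lemma pi_lattice_inj n m n' m' :
  cps_pi S (lattice_point n m) = cps_pi S (lattice_point n' m') -> n = n' /\ m = m'.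
Proof.
move=> E; have inj := cps_inj (c := S); apply: lattice_point_inj.
by apply: inj => //; rewrite inE; apply/lattice_pointP; do 2 eexists.
Qed.

Lemma offset_lattice n m i :
  offset A (lattice_point n m + cps_shift S) 0 i = (m i)%:~R + (c i - lin M n i).
Proof.
rewrite offsetD mxE -/(c i) {1}/offset row_mxKl row_mxKr -lin_mulmx mxE [in LHS]mxE.
by rewrite mxE; ring.
Qed.

Lemma offset_height n i :
  offset A (lattice_point n (height n) + cps_shift S) 0 i = phase M c n i.
Proof. by rewrite offset_lattice /height intrN /phase /frac; ring. Qed.

Lemma strip_lattice n m :
  strip S (lattice_point n m + cps_shift S) <-> m = height n.
Proof.
rewrite (stripE EA cubical); split=> [H|-> i]; last by rewrite offset_height frac_itv.
apply/funext => i; have := H i; rewrite offset_lattice => /andP[h0 h1].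
rewrite /height (_ : Num.floor _ = - m i) ?opprK//.
by apply: floor_def; rewrite intrD intrN; apply/andP; split; lra.
Qed.

Lemma cps_setE y : cps_set S y <-> exists n, y = cps_point n.
Proof.
split=> [[w [sw [z /lattice_pointP[n [m ->]] wE]] <-]|[n ->]].
  by exists n; rewrite -wE /cps_point; congr (cps_pi S (lattice_point _ _ + _));
    apply/strip_lattice; rewrite wE.
exists (lattice_point n (height n) + cps_shift S) => //; split.
  exact/strip_lattice.
by exists (lattice_point n (height n)) => //; apply/lattice_pointP; do 2 eexists.
Qed.

Lemma cps_pointB n N : cps_point (fun j => n j + N j) - cps_point n =
  cps_pi S (lattice_point N (fun i => height (fun j => n j + N j) i - height n i)).
Proof.
rewrite /cps_point -cps_piB; congr (cps_pi S _).
rewrite opprD addrACA subrr addr0 -lattice_pointB; congr (lattice_point _ _).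
by apply/funext => j; rewrite addrC addKr.
Qed.

Lemma tilde_point n : tilde S (cps_point n) = lattice_point n (height n).
Proof.
apply: xget_unique => [|z [/lattice_pointP[n' [m' ->]]]].
  by split=> //; apply/lattice_pointP; do 2 eexists.
by rewrite /cps_point !cps_piD => /addIr/pi_lattice_inj[-> ->].
Qed.

Lemma patchE Om n y : patch S Om (cps_point n) y <->
  exists N, Om (int_row N) /\ y = cps_point (fun j => n j + N j).
Proof.
have diff n' m' : lsubmx (lattice_point n' m' - lattice_point n (height n)) =
    int_row (fun j => n' j - n j).
  by rewrite linearB /= !row_mxKl -int_rowB.
split=> [[/cps_setE[n' ->]]|[N [ON ->]]].
  rewrite !tilde_point (cps_rhoE EA) (rho_imgE EA) diff => H.
  exists (fun j => n' j - n j); split=> //; congr cps_point.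
  by apply/funext => j; rewrite addrC subrK.
split; first by apply/cps_setE; eexists.
rewrite !tilde_point (cps_rhoE EA) (rho_imgE EA) diff.
by rewrite (_ : (fun _ => _) = N)//; apply/funext => j; rewrite addrC addKr.
Qed.

Lemma height_step n N i : height (fun j => n j + N j) i - height n i =
  - Num.floor (phase M c n i - lin M N i).
Proof.
rewrite /height linD /phase /frac.
rewrite (_ : c i - lin M n i - _ - _ = c i - (lin M n i + lin M N i) +
   (- Num.floor (c i - lin M n i))%:~R); last by rewrite intrN; ring.
by rewrite [in RHS]floorDrz ?intr_int// intrKfloor -opprD.
Qed.

(** By injectivity of [pi] on Z^k, a translation between patches must match points with the same
    step [N], and then the height increments agree. *)
Lemma patch_equivE Om n n' : patch_equiv S Om (cps_point n) (cps_point n') <->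
  forall N, Om (int_row N) -> forall i,
    Num.floor (phase M c n i - lin M N i) = Num.floor (phase M c n' i - lin M N i).
Proof.
have step_eq N : (forall i, Num.floor (phase M c n i - lin M N i) =
      Num.floor (phase M c n' i - lin M N i)) ->
    cps_point (fun j => n j + N j) =
    cps_point (fun j => n' j + N j) + cps_point n - cps_point n'.
  move=> E; rewrite addrAC cps_pointB -[LHS](subrK (cps_point n)) cps_pointB.
  congr (cps_pi S (lattice_point _ _) + _).
  by apply/funext => i; rewrite !height_step E.
split=> [E N ON i|E].
  have : patch S Om (cps_point n) (cps_point (fun j => n j + N j)).
    by apply/patchE; exists N.
  rewrite E => -[_ /patchE[N' [ON' ->]]]; rewrite addrAC cps_pointB.
  move=> /(canRL (addrK _)); rewrite cps_pointB => /pi_lattice_inj[NN H].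
  have := congr1 (fun f => f i) H; rewrite /= NN !height_step.
  by move=> /oppr_inj/esym.
apply/seteqP; split=> y.
  move=> /patchE[N [ON ->]]; exists (cps_point (fun j => n' j + N j)).
    by apply/patchE; exists N.
  by rewrite step_eq// => i; exact: E.
move=> [_ /patchE[N [ON ->]] <-]; apply/patchE; exists N; split=> //.
by rewrite step_eq// => i; exact: E.
Qed.

Lemma rho_img_point (Om : set 'rV[R]_d) n : rho_img S Om (cps_point n) <->
  Om (\row_j ((n j)%:~R + lsubmx (cps_shift S) 0 j + \sum_i phase M c n i * T i j)).
Proof.
rewrite /cps_point piT (rho_imgE EA).
suff -> : lsubmx (lattice_point n (height n) + cps_shift S) +
  offset A (lattice_point n (height n) + cps_shift S) *m T =
  \row_j ((n j)%:~R + lsubmx (cps_shift S) 0 j + \sum_i phase M c n i * T i j) by [].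
apply/rowP => j; rewrite linearD /= row_mxKl !mxE; congr (_ + _).
by apply: eq_bigr => i _; rewrite offset_height.
Qed.

Lemma LR_OmegaE (F : set (set 'rV[R]_d)) : LR_Omega S F <->
  exists2 C : R, 0 < C & forall Om, F Om -> forall n0 (t : 'rV[R]_d), exists n,
    [set t + C *: v | v in Om]
      (\row_j ((n j)%:~R + lsubmx (cps_shift S) 0 j + \sum_i phase M c n i * T i j)) /\
    forall N, Om (int_row N) -> forall i,
      Num.floor (phase M c n i - lin M N i) = Num.floor (phase M c n0 i - lin M N i).
Proof.
split=> -[C C0 H]; exists C => // Om FOm.
  move=> n0 t.
  have [|y [[/cps_setE[n ->] /rho_img_point yt] [_ /patch_equivE pe]]] :=
    H Om FOm [set y' | cps_set S y' /\ patch_equiv S Om y' (cps_point n0)] _ t.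
    by exists (cps_point n0) => //; apply/cps_setE; exists n0.
  by exists n.
move=> _ [_ /cps_setE[n0 ->] ->] t; have [n [nt same]] := H Om FOm n0 t.
have nY : cps_set S (cps_point n) by apply/cps_setE; exists n.
exists (cps_point n); split; first by split=> //; exact/rho_img_point.
by split=> //; exact/patch_equivE.
Qed.

End Points.

(** * Total irrationality, aperiodicity and regularity through the forms *)

Section Topology.
Variable R : realType.

Lemma row_ballP n (x y : 'rV[R]_n) r : 0 < r ->
  ball x r y <-> forall j, `|x 0 j - y 0 j| < r.
Proof.
move=> r0; split=> [[_ H] j|H]; first by have := H 0 j; rewrite -ball_normE.
by split=> // i j; rewrite ord1 -ball_normE; exact: H.
Qed.

Lemma aligned_box_interior n (a b : 'rV[R]_n) :
  (aligned_box a b)° !=set0 <-> forall j, a 0 j < b 0 j.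
Proof.
split=> [[x /nbhs_ballP[r /= r0 H]] j|ab].
  have near (s : R) : `|s| < r -> aligned_box a b (x + const_mx s).
    by move=> sr; apply: H; apply/row_ballP => // i; rewrite !mxE opprD addNKr normrN.
  have r2 : `|r / 2| < r by rewrite gtr0_norm ?divr_gt0//; lra.
  have := near _ r2 j; rewrite -normrN in r2; have := near _ r2 j; rewrite !mxE.
  by move=> /andP[? ?] /andP[? ?]; lra.
pose x := 2^-1 *: (a + b); exists x; apply/nbhs_ballP.
pose r := \big[Order.min/1]_j (2^-1 * (b 0 j - a 0 j)).
have r0 : 0 < r.
  by apply: lt_bigmin => // j _; rewrite mulr_gt0// subr_gt0.
exists r => //= y /(row_ballP _ _ r0) H j; have := H j.
have : r <= 2^-1 * (b 0 j - a 0 j) by exact: bigmin_le.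
rewrite !mxE ltr_norml => rj /andP[h1 h2]; apply/andP; split; lra.
Qed.

Lemma torus_projP n (x y : 'rV[R]_n) :
  torus_proj x = torus_proj y <-> int_lattice (x - y).
Proof. by split=> [/eqmodP|H]; last exact/eqmodP. Qed.

End Topology.

Section Density.
Variables (R : realType) (d e : nat) (A : 'M[R]_(d, e)).
Local Notation M := (fun j i => A j i).

(** A Lipschitz constant of the coordinates of [offset] for the sup norm. *)
Let kap : R := 1 + \sum_j \sum_i `|A j i|.

Let kap1 : 1 <= kap.
Proof. by rewrite lerDl; apply: sumr_ge0 => j _; exact: sumr_ge0. Qed.

Lemma mulmx_small (w : 'rV[R]_d) r i : 0 <= r -> (forall j, `|w 0 j| <= r) ->
  `|(w *m A) 0 i| <= r * \sum_j \sum_i `|A j i|.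
Proof.
move=> r0 wr; rewrite mxE; apply: le_trans (ler_norm_sum _ _ _) _.
rewrite mulr_sumr; apply: ler_sum => j _; rewrite normrM.
apply: ler_pM => //; rewrite (bigD1 i)//= lerDl; exact: sumr_ge0.
Qed.

Lemma offset_close (v w : 'rV[R]_(d + e)) r i : ball v r w ->
  `|offset A v 0 i - offset A w 0 i| <= r * kap.
Proof.
move=> vw; have r0 : 0 < r by case: vw.
move/(row_ballP _ _ r0): vw => vw.
rewrite (_ : _ - _ = (v 0 (rshift d i) - w 0 (rshift d i)) -
   ((lsubmx v - lsubmx w) *m A) 0 i); last by rewrite mulmxBl !mxE; ring.
apply: le_trans (ler_normB _ _) _; rewrite mulrDr mulr1; apply: lerD.
  exact/ltW/vw.
by apply: mulmx_small; [exact: ltW|move=> j; rewrite !mxE; exact/ltW/vw].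
Qed.

(** The orbit of the forms is the trace of [E] on the fibre of the torus over 0 in R^d / Z^d: the
    point of [E] over an integral [n] is [(0, lin n)] modulo Z^k. Sliding along [E] reduces other
    fibres to this one. *)
Lemma totally_irrationalP : totally_irrational (graph A) <-> orbit_dense M.
Proof.
have kap0 : 0 < kap := lt_le_trans ltr01 kap1.
split=> [dn g eps eps0|dn O [p Op] oO].
  pose x : 'rV[R]_(d + e) := row_mx 0 (\row_i g i).
  pose r := \big[Order.min/1]_i (eps i / (2 * kap)).
  have r0 : 0 < r.
    by apply: lt_bigmin => // i _; rewrite divr_gt0// mulr_gt0.
  have rE i : r * kap < eps i.
    have : r <= eps i / (2 * kap) by exact: bigmin_le.
    rewrite ler_pdivlMr ?mulr_gt0//.
    by have := eps0 i; nra.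
  have [||_ [[w xw <-] [v vE /torus_projP]]] := dn (@torus_proj R _ @` ball x r).
  - by exists (torus_proj x), x => //; exact: ballxx.
  (* The image of a ball is open in the quotient since its preimage is a union of lattice translates
     of the ball. *)
  - change (open (@torus_proj R (d + e) @^-1` (@torus_proj R _ @` ball x r))).
    have -> : @torus_proj R (d + e) @^-1` (@torus_proj R _ @` ball x r) =
        \bigcup_(z in @int_lattice R (d + e)) ((fun y => y + z) @^-1` ball x r).
      apply/seteqP; split=> y.
        move=> [w xw /torus_projP wy]; exists (w - y) => //=.
        by rewrite addrC subrK.
      move=> [z zint xyz]; exists (y + z) => //; apply/torus_projP.
      by rewrite addrC addKr.
    apply: bigcup_open => z _; rewrite openE => y /= xy.
    have [s /= s0 sH] : nbhs_ball (y + z) (ball x r).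
      by apply/nbhs_ballP/open_nbhs_nbhs; split=> //; exact: ball_open.
    apply/nbhs_ballP; exists s => //= y' /(row_ballP _ _ s0) yy'; apply: sH.
    by apply/(row_ballP _ _ s0) => j; rewrite !mxE opprD addrACA subrr addr0.
  rewrite /= mem_graph in vE; move/eqP: vE => vE.
  move=> /int_latticeP[f vwf].
  have vf l : v 0 l = w 0 l + (f l)%:~R.
    by have := congr1 (fun y : 'rV__ => y 0 l) vwf; rewrite !mxE => <-; ring.
  exists (fun j => f (lshift e j)) => i.
  move/(row_ballP _ _ r0): xw => xw.
  have := congr1 (fun y : 'rV_e => y 0 i) vE; rewrite [LHS]mxE vf.
  have -> : lsubmx v = lsubmx w + int_row (fun j => f (lshift e j)).
    by apply/rowP => j; rewrite !mxE vf.
  rewrite mulmxDl [RHS]mxE lin_mulmx => E.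
  have -> : lin M (fun j => f (lshift e j)) i - g i =
      (w 0 (rshift d i) - g i - (lsubmx w *m A) 0 i) + (f (rshift d i))%:~R.
    have -> : lin M (fun j => f (lshift e j)) i =
        w 0 (rshift d i) + (f (rshift d i))%:~R - (lsubmx w *m A) 0 i.
      by rewrite E [X in X - _]addrC addrK.
    by ring.
  rewrite dist_intDz; apply: le_lt_trans (dist_int_le _ 0) _; rewrite subr0.
  apply: le_lt_trans (rE i); apply: le_trans (ler_normB _ _) _.
  rewrite mulrDr mulr1; apply: lerD.
    by have := xw (rshift d i); rewrite row_mxEr mxE distrC => /ltW.
  apply: mulmx_small; first exact: ltW.
  move=> j; have := xw (lshift e j).
  by rewrite row_mxEl mxE sub0r normrN mxE => /ltW.
have [x px] : exists x, torus_proj x = p by exists (repr p); exact: reprK.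
have Ox : nbhs x (@torus_proj R _ @^-1` O) by apply: open_nbhs_nbhs; split=> //=; rewrite px.
have /nbhs_ballP[r /= r0 H] := Ox.
have [n nP] := dn (fun i => rsubmx x 0 i - (lsubmx x *m A) 0 i) (fun=> r) (fun=> r0).
(* The point of [E] over [lsubmx x + n]; subtracting the lattice point [(n, m)] brings it close to
   [x] within its class. *)
pose v := on_graph A (lsubmx x + int_row n).
have /choice[m mP] := fun i => dist_int_nearest
  (lin M n i - (rsubmx x 0 i - (lsubmx x *m A) 0 i)).
exists (torus_proj v); split; last first.
  by exists v => //=; rewrite mem_graph row_mxKl row_mxKr.
have -> : torus_proj v = torus_proj (v - lattice_point R n m).
  apply/torus_projP; rewrite opprB addrC subrK.
  by apply/lattice_pointP; do 2 eexists.
apply: H; apply/row_ballP => // l.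
rewrite -(hsubmxK x) opp_row_mx add_row_mx; case: (splitP l) => j lj.
  have -> : l = lshift e j by exact: val_inj.
  by rewrite !row_mxEl !mxE [X in `|X|](_ : _ = 0) ?normr0//; ring.
have -> : l = rshift d j by exact: val_inj.
have := nP j; rewrite mP !row_mxEr mulmxDl.
rewrite [((lsubmx x *m A) + _ - _) 0 j]mxE [((lsubmx x *m A) + _) 0 j]mxE lin_mulmx.
rewrite [(- int_row m) 0 j]mxE [int_row m 0 j]mxE -normrN => h.
by rewrite (_ : _ - _ = - (lin M n j - (rsubmx x 0 j - (lsubmx x *m A) 0 j) - (m j)%:~R));
  last ring.
Qed.

End Density.

Section CubicalSets.
Variables (R : realType) (d e : nat) (S : cut_project R (d + e) d).
Variable A : 'M[R]_(d, e).
Hypotheses (EA : cps_E S = graph A) (cubical : cubical_window S).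

Local Notation M := (fun j i => A j i).
Local Notation c := (shift_phase S A).

Lemma LR_int_rectanglesE (T : 'M[R]_(e, d)) :
  (forall v, cps_pi S v = on_graph A (lsubmx v + offset A v *m T)) ->
  LR_Omega S (@int_rectangles R d) <->
  box_repetitive M c (fun j => lsubmx (cps_shift S) 0 j) (fun i j => T i j).
Proof.
move=> piT; rewrite (LR_OmegaE EA cubical piT); split=> -[C C0 H]; exists C => //.
  move=> lo hi lohi n0 t.
  have [|n [[v vbox E] same]] :=
      H (aligned_box (int_row lo) (int_row hi)) _ n0 (\row_j t j).
    split; first by exists (int_row lo), (int_row hi); split=> //;
      apply/int_latticeP; eexists.
      by apply/aligned_box_interior => j; rewrite !mxE ltr_int; case: (lohi j).
    by move=> j; rewrite !mxE; have [/andP[? ?] _] := lohi j; rewrite lerz0 ler0z; apply/andP.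
  exists n; split=> [j|N Nbox i]; last first.
    by apply: same => j; rewrite !mxE !ler_int; exact: Nbox.
  have := congr1 (fun y : 'rV_d => y 0 j) E; rewrite !mxE => <-.
  have := vbox j; rewrite !mxE => /andP[v1 v2].
  by rewrite !lerD2l !ler_pM2l//; apply/andP.
move=> Om [[a [b [/int_latticeP[lo ->] /int_latticeP[hi ->] ->]]]].
move=> /aligned_box_interior lohi box0 n0 t.
have [|n [nt same]] := H lo hi _ n0 (fun j => t 0 j).
  move=> j; have := lohi j; have := box0 j; rewrite !mxE ltr_int lerz0 ler0z.
  by move=> -> ->.
exists n; split=> [|N Nbox i]; last first.
  by apply: same => j; have := Nbox j; rewrite !mxE !ler_int.
set x := \row_j _; exists (C^-1 *: (x - t)); last first.
  by rewrite scalerA divff ?gt_eqF// scale1r addrC subrK.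
move=> j; move: (nt j); rewrite /x !mxE => /andP[h1 h2].
by rewrite ler_pdivlMl// ler_pdivrMl//; apply/andP; split; lra.
Qed.

(** If [frac l] is not 0, the cut there leaves two arcs of positive length; by density phases occur
    in both, and their floors differ. *)
Lemma floor_phase_const (i : 'I_e) (l : R) : orbit_dense M ->
  (forall n n', Num.floor (phase M c n i - l) = Num.floor (phase M c n' i - l)) ->
  exists z : int, l = z%:~R.
Proof.
move=> dense same; have /andP[l0 l1] := frac_itv l.
have [fl0|fl0] := eqVneq (frac l) 0.
  by exists (Num.floor l); apply/eqP; rewrite -subr_eq0; apply/eqP.
have fl : 0 < frac l by rewrite lt_neqAle eq_sym fl0.
have hit (m r : R) : 0 < r -> 0 <= m - r -> m + r <= 1 ->
    exists n, m - r < phase M c n i < m + r.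
  move=> r0 mr0 mr1; have [n nP] := dense (fun i => c i - m) (fun=> r) (fun=> r0).
  exists n; apply: frac_near => //; rewrite -dist_intN.
  by rewrite (_ : - _ = lin M n i - (c i - m)); [exact: nP|ring].
have [|||n n_lt] := hit (frac l / 2) (frac l / 2); [lra|lra|lra|].
have [|||n' n_gt] := hit ((1 + frac l) / 2) ((1 - frac l) / 2); [lra|lra|lra|].
have := floor_frac_lt (phase M c n i) l.
rewrite (same n n') floor_frac_lt => E.
have : phase M c n i < frac l by lra.
by rewrite -E => ?; lra.
Qed.

(** If the forms are integral at [N], the point of [E] over [N] is a lattice vector and a period.
    Conversely, injectivity of [pi] makes a period act by the same step [N] and the same height
    increments at every point, so [floor_phase_const] makes the forms integral at [N]. *)
Lemma aperiodicP : orbit_dense M -> aperiodic_cps S <-> orbit_free M.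
Proof.
move=> dense; split=> [ap N /choice[z zP]|free x xE Yx].
  have step n : cps_point S A (fun j => n j + N j) =
      cps_point S A n + lattice_point R N z.
    apply/eqP; rewrite addrC -subr_eq cps_pointB; apply/eqP.
    rewrite (_ : (fun i => _ - _) = z).
      apply: (cps_pi_id (S := S)); rewrite EA mem_graph row_mxKl row_mxKr; apply/eqP/rowP => i.
      by rewrite lin_mulmx mxE zP.
    apply/funext => i; rewrite height_step zP -intrN floorDrz ?intr_int// intrKfloor.
    rewrite opprD opprK (_ : Num.floor _ = 0) ?oppr0 ?add0r//.
    by apply: floor_def; rewrite frac_itv.
  have /lattice_point_inj[-> _] // : lattice_point R N z = lattice_point R (fun=> 0) (fun=> 0).
  rewrite [RHS](_ : _ = 0); last first.
    by apply/rowP => l; rewrite !mxE; case: fintype.split => ?; rewrite mxE.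
  apply: ap; first by rewrite EA mem_graph row_mxKl row_mxKr; apply/eqP/rowP => i;
    rewrite lin_mulmx mxE zP.
  apply/seteqP; split=> y.
    move=> [_ /(cps_setE EA cubical)[n ->] <-]; apply/(cps_setE EA cubical).
    by eexists; rewrite -step.
  move=> /(cps_setE EA cubical)[n ->].
  exists (cps_point S A (fun j => n j - N j)); first by apply/(cps_setE EA cubical); eexists.
  by rewrite -step; congr cps_point; apply/funext => j; rewrite subrK.
have shifted n : exists N, cps_point S A (fun j => n j + N j) = cps_point S A n + x.
  have : cps_set S (cps_point S A n + x).
    rewrite -Yx; exists (cps_point S A n) => //.
    by apply/(cps_setE EA cubical); eexists.
  move=> /(cps_setE EA cubical)[n' ->]; exists (fun j => n' j - n j).
  by congr cps_point; apply/funext => j; rewrite addrC subrK.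
have [N] := shifted (fun=> 0); set n0 := (fun=> 0) => Nx.
have xN n : x = cps_pi S (lattice_point R N
    (fun i => height S A (fun j => n j + N j) i - height S A n i)).
  have E n' N' : cps_point S A (fun j => n' j + N' j) = cps_point S A n' + x ->
      x = cps_pi S (lattice_point R N'
       (fun i => height S A (fun j => n' j + N' j) i - height S A n' i)).
    by move=> H; rewrite -cps_pointB H addrC addKr.
  have [N' N'x] := shifted n; have := E _ _ N'x.
  by rewrite {1}(E _ _ Nx) => /pi_lattice_inj[NN _]; rewrite -NN in N'x *; exact: E.
have same n n' i : Num.floor (phase M c n i - lin M N i) =
    Num.floor (phase M c n' i - lin M N i).
  have := xN n'; rewrite {1}(xN n) => /pi_lattice_inj[_ /(congr1 (fun f => f i))].
  by rewrite !height_step => /oppr_inj.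
have N0 j : N j = 0.
  by apply: free => i; apply: floor_phase_const => // n n'; exact: same.
have -> : x = cps_pi S 0.
  rewrite (xN n0); congr (cps_pi S _); apply/rowP => l; rewrite !mxE.
  case: fintype.split => j; rewrite mxE ?N0// height_step.
  rewrite (_ : lin M N j = 0) ?subr0; last first.
    by rewrite /lin big1// => l' _; rewrite N0 mul0r.
  by rewrite (_ : Num.floor _ = 0) ?oppr0//; apply: floor_def; rewrite frac_itv.
by rewrite cps_pi_id ?mem0v.
Qed.

(* Near a lattice point whose offset has no integral coordinate, membership in the
   strip is locally constant. *)
Lemma regular_of_nonint :
  (forall n i (z : int), c i - lin M n i <> z%:~R) -> regular_cps S.
Proof.
move=> nonint; apply/seteqP; split=> // w0 [[_ /lattice_pointP[n [m ->]] <-] [clv]].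
apply.
set v := lattice_point R n m + cps_shift S in clv *.
pose kap : R := 1 + \sum_j \sum_i `|A j i|.
have kap0 : 0 < kap.
  by rewrite ltr_pwDl// sumr_ge0// => j _; exact: sumr_ge0.
pose x i := offset A v 0 i.
have x0 i : 0 < dist_int (x i).
  rewrite lt_neqAle dist_int_ge0 andbT; apply/eqP => /esym/dist_int_eq0[z].
  rewrite /x offset_lattice => E; apply: (nonint n i (z - m i)).
  by rewrite intrB -E; ring.
pose r := \big[Order.min/1]_i (dist_int (x i) / (2 * kap)).
have r0 : 0 < r by apply: lt_bigmin => // i _; rewrite divr_gt0// mulr_gt0.
have close w i : ball v r w -> `|x i - offset A w 0 i| < dist_int (x i).
  move=> /(offset_close A i) H; apply: le_lt_trans H _.
  have : r <= dist_int (x i) / (2 * kap) by exact: bigmin_le.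
  by rewrite -/kap ler_pdivlMr ?mulr_gt0//; have := x0 i; lra.
have same w : ball v r w -> strip S v <-> strip S w.
  move=> vw; rewrite !(stripE EA cubical); split=> H i; have := H i; have := close w i vw;
    have := dist_int_le (x i) 0; have := dist_int_le (x i) 1;
    rewrite -/(x i) subr0 -[1%:~R]/1 => d1 d0 cl /andP[h0 h1];
    move: cl; rewrite ltr_norml => /andP[c0 c1].
    rewrite ger0_norm// in d0; rewrite distrC ger0_norm ?subr_ge0 ?(ltW h1)// in d1.
    by apply/andP; split; lra.
  apply/andP; split; [rewrite leNgt|rewrite ltNge]; apply/negP => neg.
    by rewrite ltr0_norm// in d0; lra.
  by rewrite ger0_norm ?subr_ge0// in d1; lra.
have [w [sw vw]] := clv (ball v r) (nbhsx_ballx v r r0).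
have sv : strip S v by apply/(same w).
by apply/nbhs_ballP; exists r => //= w' vw'; apply/(same w').
Qed.

End CubicalSets.

(** * Construction of cubical cut and project sets *)

Section Construction.
Variables (R : realType) (d e : nat).
Local Notation k := (d + e)%N.

(** The first hypothesis makes [cograph T] a complement of the graph; the second says that it
    contains no nonzero lattice point, which is injectivity of [pi] on Z^k. *)
Lemma cut_project_exists (A : 'M[R]_(d, e)) (T : 'M[R]_(e, d)) (s : 'rV[R]_k) :
  (forall x : 'rV[R]_e, x *m T *m A = x -> x = 0) ->
  (forall n m, int_row n = int_row m *m T -> n = (fun=> 0) /\ m = (fun=> 0)) ->
  exists S : cut_project R k d,
    [/\ cps_E S = graph A, cps_shift S = s & cubical_window S].
Proof.
move=> TA free; have compl := complementary_graph TA.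
have compl_rho : complementary (graph A) (Frho R k d).
  by rewrite Frho_cograph; apply: complementary_graph => x; rewrite mulmx0 mul0mx.
have inj : set_inj (@int_lattice R k) (daddv_pi (graph A) (cograph T)).
  move=> x y; rewrite !inE => /int_latticeP[f ->] /int_latticeP[g ->] E.
  have [_] := complementary_pi (int_row f - int_row g) compl.
  rewrite linearB /= E subrr subr0 -int_rowB mem_cograph => /eqP H.
  have [|n0 m0] := free (fun j => f (lshift e j) - g (lshift e j))
    (fun i => f (rshift d i) - g (rshift d i)).
    transitivity (lsubmx (int_row (fun l => f l - g l)) : 'rV[R]_d).
      by apply/rowP => j; rewrite !mxE.
    by rewrite H; congr (_ *m T); apply/rowP => i; rewrite !mxE.
  congr int_row; apply/funext => l; apply/eqP; rewrite -subr_eq0; apply/eqP.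
  case: (splitP l) => j lj.
    rewrite (_ : l = lshift e j); last exact: val_inj.
    exact: (congr1 (fun h => h j) n0).
  rewrite (_ : l = rshift d j); last exact: val_inj.
  exact: (congr1 (fun h => h j) m0).
(* The trace on F_pi of the strip wanted; offsets ignore [E], so adding [E] recovers the strip. *)
pose W : set 'rV[R]_k := [set w | w \in cograph T /\ forall i, 0 <= offset A w 0 i < 1].
have Wsub : W `<=` [set` cograph T] by move=> w [].
pose S := @CutProject R k d (graph A) (cograph T) W s (dim_graph A) compl compl_rho inj Wsub.
exists S; split=> //; apply/seteqP.
have stripW v : strip S v <-> forall i, 0 <= offset A v 0 i < 1.
  split=> [[w [_ w01] [x xE <-]] i|v01].
    have /eqP x0 : offset A x == 0 by rewrite -(offset_graph (S := S)).
    by rewrite offsetD x0 addr0.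
  have [pE pF] := complementary_pi v compl.
  exists (v - daddv_pi (graph A) (cograph T) v); last first.
    by exists (daddv_pi (graph A) (cograph T) v) => //; rewrite subrK.
  split=> // i; rewrite (_ : offset A _ = offset A v)//.
  have /eqP p0 : offset A (daddv_pi (graph A) (cograph T) v) == 0.
    by rewrite -(offset_graph (S := S)).
  by rewrite -[in RHS](subrK (daddv_pi (graph A) (cograph T) v) v) [RHS]offsetD p0 addr0.
have frho v : lsubmx v = 0 -> forall i, offset A v 0 i = v 0 (rshift d i).
  by move=> v0 i; rewrite /offset v0 mul0mx subr0 mxE.
split=> v.
  move=> [/stripW v01]; rewrite /= mem_Frho => /eqP v0; apply/cubeP; split=> // i.
  by rewrite -frho.
move=> /cubeP[v0 v01]; split; last by rewrite /= mem_Frho v0.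
by apply/stripW => i; rewrite frho.
Qed.

(** [T] carries one coefficient [a (r i)] per block, so [T A] is diagonal with entries
    [a (r i) ^ 2], different from 1 by irrationality. An integral [m T] has entries [m_i a (r i)],
    which forces [m = 0]. *)
Lemma cubical_cps_of_blocks (a : 'I_d -> R) (b : 'I_d -> 'I_e) :
  (forall i, exists j, b j = i) ->
  (forall i, exists2 c, 0 < c & linear_bad (fun j => b j == i) a c) ->
  exists S : cut_project R k d, cubical_cps S /\ LR_Omega S (@int_rectangles R d).
Proof.
move=> surj bad; have /choice[r rP] := surj.
pose A : 'M[R]_(d, e) := \matrix_(j, i) block_coef a b j i.
have AE : (fun j i => A j i) = block_coef a b.
  by apply/funext => j; apply/funext => i; rewrite mxE.
pose T : 'M[R]_(e, d) := \matrix_(i, j) (if j == r i then a j else 0).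
have lin_r i (z : int) l : b (r i) = l ->
    lin (block_coef a b) (fun j => if j == r i then z else 0) l = z%:~R * a (r i).
  by move=> <-; rewrite lin_single /block_coef eqxx.
have irr i (z w : int) : z%:~R * a (r i) = w%:~R -> z = 0.
  move=> E; have := block_free bad (N := fun j => if j == r i then z else 0) (i := i) (z := w).
  by rewrite lin_r// => /(_ E (r i) (rP i)); rewrite eqxx.
have TA i l : (T *m A) i l = if i == l then a (r i) ^+ 2 else 0.
  rewrite mxE (bigD1 (r i))//= !mxE eqxx big1 ?addr0 => [|j /negbTE jr]; last first.
    by rewrite mxE jr mul0r.
  by rewrite /block_coef rP; case: eqP => _; rewrite ?mulr0// expr2.
(* With offset [a (r i) / 2], an integral coordinate at [n] would make the form integral at
   [2 n - e_(r i)], whose [r i]-th coordinate is odd, against [block_free]; this gives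
   regularity. *)
pose s : 'rV[R]_k := row_mx 0 (\row_i (a (r i) / 2)).
have [||S [ES Ss cub]] := @cut_project_exists A T s.
- move=> x; rewrite -mulmxA => /rowP xE; apply/rowP => l; have := xE l.
  rewrite mxE (bigD1 l)//= TA eqxx big1 ?addr0 => [|i /negbTE il]; last first.
    by rewrite TA il mulr0.
  rewrite mxE => /eqP; rewrite -subr_eq0 -[X in _ - X]mulr1 -mulrBr mulf_eq0.
  case/orP => [/eqP//|]; rewrite subr_eq0 sqrf_eq1.
  by case/orP => /eqP al; [have := irr l 1 1|have := irr l 1 (-1)];
    rewrite al mul1r => /(_ erefl).
- move=> n m E; have m0 : m = fun=> 0.
    apply/funext => i; apply: (irr i _ (n (r i))).
    have := congr1 (fun y : 'rV_d => y 0 (r i)) E; rewrite !mxE => ->.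
    rewrite (bigD1 i)//= !mxE eqxx big1 ?addr0// => i' /negbTE ii'.
    rewrite !mxE; case: eqP => [rr|]; last by rewrite mulr0.
    by rewrite -(rP i) -(rP i') rr eqxx in ii'.
  split=> //; apply: (@int_row_inj R); rewrite E m0.
  by apply/rowP => j; rewrite !mxE big1// => i _; rewrite mxE mul0r.
have cE i : shift_phase S A i = a (r i) / 2.
  by rewrite /shift_phase Ss /offset row_mxKl row_mxKr mul0mx subr0 mxE.
have dense := block_dense surj bad.
exists S; split; first split=> //.
- apply: (regular_of_nonint ES cub) => n i z; rewrite AE cE => E.
  pose N j := n j + n j - (if j == r i then 1 else 0).
  have : N (r i) = 0.
    apply: (block_free bad (z := - (z + z)) _ (rP i)).
    by rewrite linB linD lin_r// mul1r intrN intrD -E; field.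
  by rewrite /N eqxx; lia.
- by rewrite ES; apply/totally_irrationalP; rewrite AE.
- apply/(aperiodicP ES cub); rewrite AE//; exact: block_free_all.
have [T' piT] := cps_piE ES.
apply/(LR_int_rectanglesE ES cub piT); rewrite AE.
exact: repetitive_of_blocks.
Qed.

Lemma blocks_of_cubical_cps (S : cut_project R k d) :
  cubical_cps S -> LR_Omega S (@int_rectangles R d) ->
  exists (a : 'I_d -> R) (b : 'I_d -> 'I_e), (forall i, exists j, b j = i) /\
  forall i, exists2 c, 0 < c & linear_bad (fun j => b j == i) a c.
Proof.
move=> [_ irr ap cub] LR; have [A EA] := cps_E_graph S.
have [T piT] := cps_piE EA.
move: irr; rewrite EA => /totally_irrationalP dense.
apply: (blocks_of_repetitive dense); first exact/(aperiodicP EA cub dense).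
exact: (proj1 (LR_int_rectanglesE EA cub piT) LR).
Qed.

Lemma cubical_LR_Omega_iff :
  (exists S : cut_project R k d, cubical_cps S /\ LR_Omega S (@int_rectangles R d))
  <->
  (exists m : 'I_e -> nat,
      [/\ forall i, (0 < m i)%N,
          d = (\sum_(i < e) m i)%N
        & forall i, exists alpha : 'I_(m i) -> R, (0%:E < mult_liminf alpha)%E]).
Proof.
rewrite (condition_blocks R d e); split.
  move=> [S [cub /(blocks_of_cubical_cps cub)[a [b [surj bad]]]]].
  by exists a, b; split=> // i; exact: simult_of_linear.
move=> [a [b [surj bad]]]; apply: (cubical_cps_of_blocks surj) => i.
exact: linear_of_simult.
Qed.

End Construction.

Theorem theorem1p6 (R : realType) (k d : nat) (hd : (1 <= d)%N)
    (hk : (d < k)%N) :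
  (exists S : cut_project R k d,
      cubical_cps S /\ LR_Omega S (@int_rectangles R d))
  <->
  (exists m : 'I_(k - d) -> nat,
      [/\ forall i, (0 < m i)%N,
          d = (\sum_(i < k - d) m i)%N
        & forall i, exists alpha : 'I_(m i) -> R,
            (0%:E < mult_liminf alpha)%E]).
Proof.
have [e ->] : exists e, k = (d + e)%N by exists (k - d)%N; rewrite subnKC// ltnW.
by rewrite addKn; exact: cubical_LR_Omega_iff.
Qed.
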